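(* For every integer $n>2$, the number of pairs $(s,t)\in S_n\times S_n$ such that $[s,t]=sts^{-1}t^{-1}$ is a $3$-cycle and $\langle s,t\rangle$ equals $A_n$ or $S_n$ is $$\#\mathcal{A}(n)=\frac{3}{8}(n-2)\,J_2(n)\,n!.$$
   Context: Permutations compose as functions. $J_2(n)=n^2\prod_{p\mid n,\ p\text{ prime}}(1-p^{-2})$ is Jordan's totient function of order $2$. *)

(* Defs.v *)
From HB Require Import structures.
From mathcomp Require Import all_boot all_order all_algebra all_fingroup all_solvable.
Set Implicit Arguments. Unset Strict Implicit. Unset Printing Implicit Defensive.
Import Order.TTheory GRing.Theory Num.Theory.

Definition J2 (n : nat) : rat :=
  ((n%:R : rat) ^+ 2 * \prod_(p <- primes n) (1 - ((p%:R : rat) ^+ 2)^-1))%R.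

(* In mathcomp, (s * t) x = t (s x).  The paper composes permutations as
   functions, so the function s o t o s^-1 o t^-1 is the mathcomp product
   t^-1 * s^-1 * t * s. *)
Definition fcomm (n : nat) (s t : 'S_n) : 'S_n := (t^-1 * s^-1 * t * s)%g.

Definition is_3cycle (n : nat) (c : 'S_n) : bool :=
  [exists a : 'I_n, exists b : 'I_n, exists d : 'I_n,
     [&& a != b, b != d, a != d,
         c a == b, c b == d, c d == a &
         [forall x : 'I_n, (x \notin [:: a; b; d]) ==> (c x == x)]]].

Definition cA (n : nat) : {set 'S_n * 'S_n} :=
  [set st : 'S_n * 'S_n |
     is_3cycle (fcomm st.1 st.2) &&
     ((<<[set st.1; st.2]>>%g == ('Alt_('I_n))%g) ||
      (<<[set st.1; st.2]>>%g == ('Sym_('I_n))%g))].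

(* Main.v *)
(* Write c = [s, t], a 3-cycle.  Call f : 'I_n -> F_p a potential when f o s - f
   and f o t - f are constant.  The normal closure N of c in G = <s, t> is
   generated by 3-cycles and G / N is abelian; hence either N is transitive and
   contains the alternating group, or the abelian group G / N permuting the
   N-orbits yields a non-constant potential.  So (s, t) is counted exactly when c
   is a 3-cycle and every potential is constant.

   Since t s t^-1 = c^-1 s has the cycle type of s, the support of c meets one or
   two cycles of s (the "cylinders" of the associated square-tiled surface).
   - One cycle: s must be an n-cycle, c is given by two gaps j < i, and the
     condition on potentials is gcd(n, i, j) = 1.
   - Two cycles, of lengths w1 < w2: t = rho u, where u commutes with s and rho
     exchanges w1 consecutive points of the two cycles.  The pair (s, u) consists
     of two tori with widths w_i, heights h_i and twists t_i, where
     w1 h1 + w2 h2 = n, and the condition on potentials is gcd(h1, h2) = 1 and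
     gcd(w1, w2, h1 t2 - h2 t1) = 1.
   In the second case the twists contribute w1 w2 psi(gcd(w1, w2)), with
   psi(g) = totient(g) / g, and the sum over (w1, w2, h1, h2) is evaluated by
   Liouville's bijection (a, b, x, y) |-> (a, a + b, x - y, y) between the
   solutions of a x + b y = n with y < x and those with a < b. *)
Require Import Defs.
From HB Require Import structures.
From mathcomp Require Import all_boot all_order all_algebra all_fingroup all_solvable.
From mathcomp Require Import zify ring lra.
Set Implicit Arguments. Unset Strict Implicit. Unset Printing Implicit Defensive.
Import Order.TTheory GRing.Theory Num.Theory.
Local Open Scope group_scope.

(** * Groups generated by 3-cycles *)

(** The commutator is always used in the form [c (t (s x)) = s (t x)]: [t] conjugates [s] to
    [s * c^-1]. So for given [s] and [c] a partner [t] can exist only if passing from [s] to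
    [s * c^-1] keeps all cycle lengths, and this is what restricts the position of the support of
    [c] on the cycles of [s]. Potentials take values in prime fields because a nontrivial abelian
    quotient has a quotient of prime order; generation then becomes a few linear equations modulo p,
    hence a gcd condition. In both counts a base point (or two) is fixed first. It removes all
    automorphisms, so labelling contributes exactly n!. The obstacle in the last sum is the factor
    psi(gcd(w1, w2)). Liouville's bijection preserves gcd(a, b), so the factor is carried along and
    only diagonal sums have to be computed; there it becomes psi(gcd(n, b)), whose moments are Euler
    products. The totients produced by the two counts, -n totient(n)/2 and +n totient(n)/2 per
    labelling, cancel. *)

Section ThreeCycles.
Variable T : finType.
Implicit Types (x y z : T) (c s t : {perm T}) (D : {set T}).

Definition cycle3 c x y z : Prop :=
  [/\ uniq [:: x; y; z], c x = y, c y = z, c z = x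
    & forall u, u \notin [:: x; y; z] -> c u = u].

Definition c3 x y z : {perm T} := tperm x y * tperm x z.

Lemma cycle3_rot c x y z : cycle3 c x y z -> cycle3 c y z x.
Proof.
case=> U cx cy cz cf; split=> // [|u].
  by move: U; rewrite /= !inE !negb_or !andbT -!andbA ![x == _]eq_sym => /and3P[-> -> ->].
by move=> h; apply: cf; move: h; rewrite !inE !negb_or => /and3P[-> -> ->].
Qed.

Lemma cycle3_c3 x y z : uniq [:: x; y; z] -> cycle3 (c3 x y z) x y z.
Proof.
move=> U; split=> //; move: U; rewrite /= !inE !negb_or !andbT -!andbA => /and3P[xy xz yz].
- by rewrite permM tpermL tpermD // eq_sym.
- by rewrite permM tpermR tpermL.
- by rewrite permM [tperm x y z]tpermD ?tpermR.
move=> u; rewrite !inE !negb_or => /and3P[ux uy uz].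
by rewrite permM [tperm x y u]tpermD 1?eq_sym // tpermD // eq_sym.
Qed.

Lemma cycle3_inj c c' x y z : cycle3 c x y z -> cycle3 c' x y z -> c = c'.
Proof.
case=> _ cx cy cz cf [_ c'x c'y c'z c'f]; apply/permP=> u.
have [->|ux] := eqVneq u x; first by rewrite cx.
have [->|uy] := eqVneq u y; first by rewrite cy.
have [->|uz] := eqVneq u z; first by rewrite cz.
by rewrite cf ?c'f // !inE !negb_or ux uy uz.
Qed.

Lemma cycle3_eq c x y z : cycle3 c x y z -> c = c3 x y z.
Proof. by move=> H; apply: (cycle3_inj H); apply: cycle3_c3; case: H. Qed.

Lemma c3_rot x y z : uniq [:: x; y; z] -> c3 x y z = c3 y z x.
Proof. by move=> U; apply/cycle3_eq/cycle3_rot/cycle3_c3. Qed.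

Lemma c3J x y z s : c3 x y z ^ s = c3 (s x) (s y) (s z).
Proof. by rewrite /c3 conjMg !tpermJ. Qed.

Lemma c3V x y z : (c3 x y z)^-1 = c3 x z y.
Proof. by rewrite /c3 invMg !tpermV. Qed.

Lemma cycle3J c x y z s : cycle3 c x y z -> cycle3 (c ^ s) (s x) (s y) (s z).
Proof.
move=> H; rewrite (cycle3_eq H) c3J; apply: cycle3_c3; case: H => U _ _ _ _.
by rewrite -[[:: s x; _; _]]/(map s [:: x; y; z]) map_inj_uniq //; apply: perm_inj.
Qed.

Lemma cycle3_moved c x y z u : cycle3 c x y z -> c u != u ->
  cycle3 c u (c u) (c (c u)).
Proof.
move=> H; have H2 := cycle3_rot H; have H3 := cycle3_rot H2.
case: (H) => U cx cy cz cf.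
have [->|ux] := eqVneq u x; first by rewrite cx cy.
have [->|uy] := eqVneq u y; first by rewrite cy cz.
have [->|uz] := eqVneq u z; first by rewrite cz cx.
by rewrite cf ?eqxx // !inE !negb_or ux uy uz.
Qed.

Variable H : {group {perm T}}.

Definition c3good D := forall x y z, x \in D -> y \in D -> z \in D ->
  uniq [:: x; y; z] -> c3 x y z \in H.

Lemma uniq3 x y z : uniq [:: x; y; z] = [&& x != y, x != z & y != z].
Proof. by rewrite /= !inE !negb_or !andbT -andbA. Qed.

(** Conjugation by [c3 x z u], which is available inside [D], carries the pair [x], [z] to [z], [u]
    and fixes the outside point [y]. *)
Lemma c3good_step D x z u y : c3good D -> x \in D -> z \in D -> u \in D -> y \notin D ->
  uniq [:: x; z; u] -> c3 x y z \in H -> c3 z y u \in H.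
Proof.
move=> gD Dx Dz Du Dy U Hx; have h := gD x z u Dx Dz Du U.
have [_ e1 e2 e3 e4] := cycle3_c3 U.
have <- : c3 x y z ^ c3 x z u = c3 z y u; last by rewrite groupJ.
rewrite c3J e1 e2 e4 // !inE !negb_or; apply/and3P.
by split; apply: contraNneq Dy => ->.
Qed.

Lemma c3good_sym x y z : uniq [:: x; y; z] -> c3 x y z \in H -> c3 z y x \in H.
Proof.
by move=> U h; rewrite -groupV c3V c3_rot // -(rot_uniq 1).
Qed.

(** One 3-cycle through the new point suffices: steps and reversals move its two old points to any
    pair [u], [v] of [D], which is [Q]. Coincidences with [x] or [z] are treated apart because a
    step needs three distinct points. *)
Lemma c3good_add D x z y : c3good D -> x \in D -> z \in D -> y \notin D ->
  x != z -> c3 x y z \in H -> c3good (y |: D).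
Proof.
move=> gD Dx Dz Dy xz Hx.
have nD u : u \in D -> u != y by move=> Du; apply: contraNneq Dy => <-.
have st x' z' u : x' \in D -> z' \in D -> u \in D -> uniq [:: x'; z'; u] ->
  c3 x' y z' \in H -> c3 z' y u \in H.
  by move=> ? ? ? U; apply: c3good_step gD _ _ _ _ U.
have sy x' z' : x' \in D -> z' \in D -> x' != z' -> c3 x' y z' \in H -> c3 z' y x' \in H.
  by move=> X Z xz'; apply: c3good_sym; rewrite uniq3 nD // xz' eq_sym nD.
have Q u v : u \in D -> v \in D -> u != v -> c3 u y v \in H.
  move=> Du Dv uv.
  have Hz := sy x z Dx Dz xz Hx.
  have [eu|ux] := eqVneq u x.
    have [->|vz] := eqVneq v z; first by rewrite eu.
    subst u; apply: (st z x v) => //; rewrite uniq3 uv andbT eq_sym xz /=.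
    by rewrite eq_sym.
  have [eu|uz] := eqVneq u z.
    have [->|vx] := eqVneq v x; first by rewrite eu.
    subst u; apply: (st x z v) => //; rewrite uniq3 uv andbT xz /=.
    by rewrite eq_sym.
  have Hu : c3 z y u \in H by apply: (st x z u) => //; rewrite uniq3 xz eq_sym ux eq_sym uz.
  have [->|vz] := eqVneq v z; first by apply: sy; rewrite // eq_sym.
  by apply: (st z u v) => //; rewrite uniq3 uv andbT ![z == _]eq_sym uz.
move=> a b d Da Db Dd U; move: (U); rewrite uniq3 => /and3P[ab ad bd].
have inD u : u \in y |: D -> u != y -> u \in D by rewrite !inE => /predU1P[->|//]; rewrite eqxx.
have [ay|ay] := eqVneq a y.
  rewrite ay in ab ad U *; rewrite -c3_rot; last by rewrite -(rot_uniq 1).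
  by apply: Q; rewrite 1?inD // 1?eq_sym.
have [b_y|b_y] := eqVneq b y.
  by rewrite b_y in ab bd U *; apply: Q; rewrite ?inD // eq_sym.
have [dy|dy] := eqVneq d y; last by apply: gD; rewrite ?inD.
by rewrite dy in ad bd U *; rewrite c3_rot //; apply: Q; rewrite ?inD // eq_sym.
Qed.

(** If [z] is in [D], then [c] itself is a 3-cycle with a single point outside. Otherwise [c] meets
    [D] only in [x], and conjugating a 3-cycle [c3 x u v] of [D] by [c] gives [c3 y u v], again with
    a single point outside. *)
Lemma c3good_grow D c x y z : c3good D -> 2 < #|D| -> cycle3 c x y z -> c \in H ->
  x \in D -> y \notin D -> exists2 w, w \notin D & c3good (w |: D).
Proof.
move=> gD oD hc Hc Dx Dy; exists y => //.
have ec := cycle3_eq hc; have U : uniq [:: x; y; z] by case: hc.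
move: (U); rewrite uniq3 => /and3P[xy xz yz].
have [Dz|Dz] := boolP (z \in D).
  by apply: c3good_add gD Dx Dz Dy xz _; rewrite -ec.
have [u [v [Du Dv Uv]]] : exists u v, [/\ u \in D, v \in D & uniq [:: x; u; v]].
  have: 1 < #|D :\ x| by move: oD; rewrite (cardsD1 x) Dx.
  case/card_gt1P=> u [v []]; rewrite !inE => /andP[ux Du] /andP[vx Dv] uv.
  by exists u, v; split=> //; rewrite uniq3 uv ![x == _]eq_sym ux vx.
move: (Uv); rewrite uniq3 => /and3P[xu xv uv].
apply: (c3good_add gD Dv Du Dy); first by rewrite eq_sym.
have h := gD _ _ _ Dx Du Dv Uv.
have U' : uniq [:: v; y; u].
  rewrite uniq3 [v == u]eq_sym uv andTb.
  by apply/andP; split; apply: contraNneq Dy; [move=> <- | move=> ->].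
rewrite c3_rot //.
have <- : c3 x u v ^ c = c3 y u v; last by rewrite groupJ.
case: hc => _ cx cy cz cf; rewrite c3J cx !cf // !inE !negb_or.
  rewrite eq_sym xv /=.
  by apply/andP; split; [apply: contraNneq Dy => <- | apply: contraNneq Dz => <-].
rewrite eq_sym xu /=.
by apply/andP; split; [apply: contraNneq Dy => <- | apply: contraNneq Dz => <-].
Qed.

Lemma c3good_Alt : c3good [set: T] -> 'Alt_T \subset H.
Proof.
move=> g.
have g1 x y z : x != y -> x != z -> tperm x y * tperm x z \in H.
  move=> xy xz; have [->|yz] := eqVneq y z; first by rewrite tperm2 group1.
  by apply: g; rewrite ?inE // uniq3 xy xz yz.
have g2 x y z w : x != y -> z != w -> tperm x y * tperm z w \in H.
  move=> xy zw; have [e|xz] := eqVneq z x; first by rewrite e in zw *; apply: g1.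
  (* Inserting the transposition of [x] and [z] twice splits the product into two products of
     transpositions that share a point. *)
  rewrite -[tperm z w]mul1g -(tperm2 z x) {1}[tperm z x]tpermC -mulgA (mulgA (tperm x y)).
  by rewrite groupM ?g1 // eq_sym.
have g3 m (ts : seq (T * T)) : size ts <= m -> all dpair ts -> ~~ odd (size ts) ->
  \prod_(t <- ts) tperm t.1 t.2 \in H.
  elim: m ts => [|m IH] [|t1 [|t2 ts]] //=; rewrite ?big_nil ?group1 // => sz.
  case/and3P=> d1 d2 dts; rewrite negbK => ev; rewrite !big_cons mulgA groupM ?g2 //.
  by apply: IH => //; apply: ltnW; rewrite ltnS in sz.
apply/subsetP=> s; rewrite Alt_even; have [ts -> dts] := prod_tpermP s.
by rewrite odd_perm_prod // => ev; apply: (g3 (size ts)).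
Qed.

(** A good set [D] is grown from the support of one 3-cycle. While [D] is not everything,
    transitivity forbids that all generators preserve it, so some 3-cycle of [C] carries a point of
    [D] outside and [c3good_grow] applies. *)
Lemma transitive_c3_Alt (C : {set {perm T}}) : H :=: <<C>> ->
  (forall c, c \in C -> exists x y z, cycle3 c x y z) -> C != set0 ->
  [transitive H, on [set: T] | 'P] -> 'Alt_T \subset H.
Proof.
move=> eH C3 /set0Pn[c0 Cc0] trH; apply: c3good_Alt.
have sCH c : c \in C -> c \in H by move=> Cc; rewrite eH mem_gen.
have main m D : #|~: D| <= m -> 2 < #|D| -> c3good D -> c3good [set: T].
  elim: m D => [|m IH] D lem oD gD.
    suff <- : D = [set: T] by [].
    by apply/eqP; rewrite -[D]setCK -setC0 (inj_eq (@setC_inj _)) -cards_eq0 -leqn0.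
  have [eD|nD] := eqVneq D setT; first by rewrite -eD.
  have [c Cc [x Dx Dcx]] : exists2 c, c \in C & exists2 x, x \in D & c x \notin D.
    have [/exists_inP[c Cc /exists_inP[x Dx cx]]|] :=
      boolP [exists c in C, exists x in D, c x \notin D]; first by exists c => //; exists x.
    rewrite negb_exists_in => /forall_inP hC; case/eqP: nD.
    have sH : H \subset 'N(D | 'P).
      rewrite eH gen_subG; apply/subsetP=> c /hC; rewrite negb_exists_in => /forall_inP hc.
      rewrite inE; apply/andP; split; first by rewrite inE.
      by rewrite inE; apply/subsetP=> x Dx; rewrite inE /= apermE; move: (hc x Dx); rewrite negbK.
    have [x Dx] : exists x, x \in D by apply/set0Pn; rewrite -card_gt0; lia.
    apply/setP=> y; rewrite inE.
    have [h Hh ->] := atransP2 trH (in_setT x) (in_setT y).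
    by rewrite (astabsP (subsetP sH h Hh)).
  have [a [b [d h3]]] := C3 c Cc.
  have hx : c x != x by apply: contraNneq Dcx => ->.
  have [w Dw gw] := c3good_grow gD oD (cycle3_moved h3 hx) (sCH _ Cc) Dx Dcx.
  apply: IH gw; last by rewrite cardsU1 Dw; lia.
  by move: (cardsC D) (cardsC (w |: D)); rewrite cardsU1 Dw; lia.
have [x [y [z h]]] := C3 _ Cc0.
have U : uniq [:: x; y; z] by case: h.
have Hxyz : c3 x y z \in H by rewrite -(cycle3_eq h) sCH.
apply: (main #|~: [set x; y; z]| [set x; y; z]) => //.
  rewrite setUC cardsU1 cards2 !inE; move: U; rewrite uniq3 => /and3P[xy xz yz].
  by rewrite ![z == _]eq_sym (negPf xz) (negPf yz) xy.
move=> a b d Da Db Dd U'.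
have h2 := c3good_sym U Hxyz.
have r1 := c3_rot U; have r2 : c3 y z x = c3 z x y by apply: c3_rot; rewrite -(rot_uniq 2).
have U2 : uniq [:: z; y; x] by rewrite -rev_uniq.
have r3 := c3_rot U2; have r4 : c3 y x z = c3 x z y by apply: c3_rot; rewrite -(rot_uniq 2).
move: U' Da Db Dd; rewrite uniq3 !inE -!orbA => /and3P[ab ad bd].
by move=> /or3P[] /eqP ea /or3P[] /eqP eb /or3P[] /eqP ed; move: ab ad bd; subst a b d;
  rewrite ?eqxx // => _ _ _; rewrite -?r2 -?r1 // -?r4 -?r3.
Qed.
End ThreeCycles.

(** * Potentials *)

Definition rigid (T : finType) (s t : {perm T}) : Prop :=
  forall p (f : T -> 'F_p) (a b : 'F_p), prime p ->
    (forall x, f (s x) = f x + a)%R -> (forall x, f (t x) = f x + b)%R ->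
    forall x y, f x = f y.

Lemma Fp_nat_eq0 p k : prime p -> ((k%:R : 'F_p) == 0)%R = (p %| k).
Proof. by move=> pr; rewrite (dvdn_pcharf (pchar_Fp pr)). Qed.

(** The character is the exponent with respect to a generator of the cyclic quotient. Exponents add
    only modulo the order, which is the prime p, hence the target field. *)
Lemma prime_index_character (gT : finGroupType) (G M : {group gT}) :
    M <| G -> prime #|G / M| ->
  exists2 lam : gT -> 'F_(#|G / M|),
    {in G &, forall x y, lam (x * y) = (lam x + lam y)%R} &
    {in G, forall x, (lam x == 0%R) = (x \in M)}.
Proof.
move=> nMG pr; set p := #|G / M| in pr *.
have [a ea] := cyclicP (prime_cyclic pr).
have oa : #[a] = p by rewrite /p ea.
pose k x : nat := odflt (@Ordinal #[a] 0 (order_gt0 a)) [pick k : 'I_#[a] | coset M x == a ^+ k].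
have kP x : x \in G -> coset M x = a ^+ k x.
  move=> Gx; rewrite /k; case: pickP => [i /eqP //|no].
  have: coset M x \in <[a]> by rewrite -ea mem_quotient.
  case/cyclePmin=> i lti e; by have := no (Ordinal lti); rewrite /= e eqxx.
have nM x : x \in G -> x \in 'N(M) by apply/subsetP/normal_norm.
have p0 : (#[a]%:R = 0 :> 'F_p)%R by apply/eqP; rewrite Fp_nat_eq0 // oa.
exists (fun x => (k x)%:R)%R => [x y Gx Gy|x Gx].
  rewrite -natrD; apply/eqP.
  have /eqP : a ^+ k (x * y) = a ^+ (k x + k y).
    by rewrite expgD -!kP ?groupM // morphM ?nM.
  rewrite eq_expg_mod_order oa => /eqP e.
  by rewrite -(Fp_nat_mod pr) e Fp_nat_mod.
rewrite Fp_nat_eq0 // -oa order_dvdn -kP //.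
by apply/eqP/idP => [/coset_idr->|/coset_id]; rewrite ?nM.
Qed.

Section Rigid.
Variable T : finType.
Implicit Types (s t c : {perm T}).

(** If [N] is not transitive, the group [K] below is proper. A maximal subgroup [M] above it
    contains the derived group, so it is normal of prime index, and its character, evaluated on
    elements carrying [x] to a given point, is a non-constant potential. *)
Lemma rigid_Alt s t x y z : cycle3 (t^-1 * s^-1 * t * s) x y z -> rigid s t ->
  'Alt_T \subset <<[set s; t]>>.
Proof.
set c := _ * s => hc rig.
pose G := <<[set s; t]>>%G; pose N := <<c ^: G>>%G.
have Gs : s \in G by rewrite mem_gen // !inE eqxx.
have Gt : t \in G by rewrite mem_gen // !inE eqxx orbT.
have Gc : c \in G by rewrite !groupM ?groupV.
have sNG : N \subset G.
  by rewrite gen_subG; apply/subsetP=> g /imsetP[h Gh ->]; rewrite groupJ.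
have nNG : G \subset 'N(N) by apply/norms_gen/class_norm.
have Nc : c \in N by rewrite mem_gen // class_refl.
have GN : G^`(1) \subset N.
  have ec : c = [~ t, s] by rewrite /c commgEl conjgE !mulgA.
  apply: der1_min => //; rewrite quotient_gen; last by rewrite -(gen_subG _ 'N(_)).
  rewrite abelian_gen; apply: quotient_cents2r; rewrite gen_subG.
  apply/subsetP=> w /imset2P[u v]; rewrite !inE.
  case/orP=> /eqP->; case/orP=> /eqP-> ->; rewrite ?commgg ?group1 //.
    by rewrite -invg_comm groupV -ec.
  by rewrite -ec.
have trG : [transitive G, on [set: T] | 'P].
  apply/imsetP; exists x => //; apply/setP=> v; rewrite inE.
  (* The indicator of an orbit is a potential with both increments zero, so rigidity includes
     transitivity of [G]. *)
  pose f v : 'F_2 := (if v \in orbit 'P G x then 1 else 0)%R.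
  have fs h w : h \in G -> f (h w) = (f w + 0)%R.
    by move=> Gh; rewrite addr0 /f -[h w]/('P%act w h) orbit_actr.
  have := @rig 2 f 0%R 0%R isT (fun w => fs s w Gs) (fun w => fs t w Gt) v x.
  by rewrite /f orbit_refl; case: (v \in _).
suff trN : [transitive N, on [set: T] | 'P].
  apply: subset_trans sNG; apply: (@transitive_c3_Alt _ N (c ^: G)) => //.
    by move=> _ /imsetP[h _ ->]; exists (h x), (h y), (h z); apply: cycle3J.
  by apply/set0Pn; exists c; rewrite class_refl.
(* [K] is the stabilizer in [G] of the [N]-orbit of [x]; it equals [G] exactly when [N] is
   transitive. *)
pose K := (N <*> 'C_G[x | 'P])%G.
have sKG : K \subset G by rewrite join_subG sNG subsetIl.
have [eK|[M maxM sKM]] := maximal_exists sKG.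
  apply/imsetP; exists x => //; apply/setP=> v; rewrite inE; apply/esym.
  have [g Gg ->] := atransP2 trG (in_setT x) (in_setT v).
  have : g^-1 \in K by rewrite groupV eK.
  rewrite /= norm_joinEr; last by apply: subset_trans nNG; apply: subsetIl.
  case/mulsgP=> n k Nn; rewrite inE => /andP[Gk /astab1P ek] eg.
  apply/orbitP; exists n^-1; first by rewrite groupV.
  have -> : g = k^-1 * n^-1 by rewrite -invMg -eg invgK.
  by rewrite actM -{2}ek actK.
have sNM : N \subset M by apply: subset_trans sKM; apply: joing_subl.
have sMG : M \subset G by case/maxgroupP: (maxM) => /proper_sub.
have nMG : M <| G by apply: sub_der1_normal sMG; apply: subset_trans sNM.
have prM : prime #|G / M|.
  apply: simple_sol_prime.
    by apply/abelian_sol/sub_der1_abelian/(subset_trans GN).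
  rewrite quotient_simple //; apply/maxgroupP; case/maxgroupP: maxM => prM mx.
  split; first by rewrite prM normal_norm.
  by move=> L /andP[prL _] sML; apply: mx.
have [lam lamM lamK] := prime_index_character nMG prM.
pose g v := odflt 1 [pick h in G | h x == v].
have gP v : g v \in G /\ (g v) x = v.
  rewrite /g; case: pickP => [h /andP[Gh /eqP]//|no].
  have [h Gh e] := atransP2 trG (in_setT x) (in_setT v).
  by have := no h; rewrite Gh e eqxx.
(* The stabilizer of [x] lies in [M], so [lam (g v)] depends only on the point [v] and not on the
   chosen [g v]. *)
have lamE h h' : h \in G -> h' \in G -> h x = h' x -> lam h = lam h'.
  move=> Gh Gh' e; apply/eqP; rewrite -subr_eq0.
  have : lam (h * h'^-1) == 0%R.
    have Gq : h * h'^-1 \in G by rewrite groupM ?groupV.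
    rewrite lamK //; apply: (subsetP sKM); apply: mem_gen.
    rewrite inE; apply/orP; right; rewrite inE Gq /=.
    by apply/astab1P; rewrite /= apermE permM e permK.
  move/eqP=> e0; have := lamM _ _ (groupM Gh (groupVr Gh')) Gh'.
  by rewrite mulgKV e0 add0r => ->; rewrite subrr.
have step h v : h \in G -> lam (g (h v)) = (lam (g v) + lam h)%R.
  move=> Gh; have [Gv ev] := gP v; have [Ghv ehv] := gP (h v).
  by rewrite -lamM //; apply: lamE; rewrite ?groupM // permM ev.
have cst := @rig _ (fun v => lam (g v)) (lam s) (lam t) prM
  (fun v => step s v Gs) (fun v => step t v Gt).
have GM : G \subset M.
  apply/subsetP=> h Gh; rewrite -lamK //; have := step h x Gh.
  by rewrite (cst (h x) x) -{1}[lam (g x)]addr0 => /addrI <-.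
by case/maxgroupP: maxM; rewrite properE GM andbF.
Qed.
End Rigid.

(** The permutations respecting the fibres of [f] form a group, which therefore contains the
    alternating group. The 3-cycle [c3 x y z] carries the pair [x], [y] to [y], [z], so every [z]
    joins their fibre. *)
Lemma Alt_no_blocks (T : finType) (U : eqType) (s t : {perm T}) (f : T -> U) (x y : T) :
    'Alt_T \subset <<[set s; t]>> ->
    (forall u v, f u = f v -> f (s u) = f (s v)) ->
    (forall u v, f u = f v -> f (t u) = f (t v)) ->
  x != y -> f x = f y -> forall u v, f u = f v.
Proof.
move=> sA fs ft xy exy.
pose P := [set g : {perm T} | [forall u, forall v, (f u == f v) ==> (f (g u) == f (g v))]].
have PP (g : {perm T}) : reflect (forall u v, f u = f v -> f (g u) = f (g v)) (g \in P).
  rewrite inE; apply: (iffP forallP) => [h u v e|h u].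
    by apply/eqP; move/forallP: (h u) => /(_ v); rewrite e eqxx.
  by apply/forallP=> v; apply/implyP=> /eqP e; apply/eqP/h.
have gP : group_set P.
  apply/group_setP; split; first by apply/PP => u v; rewrite !perm1.
  by move=> g h /PP Pg /PP Ph; apply/PP => u v e; rewrite !permM; apply/Ph/Pg.
have sP : 'Alt_T \subset Group gP.
  apply: subset_trans sA _; rewrite gen_subG; apply/subsetP=> g.
  by case/set2P=> ->; apply/PP.
have fx z : f z = f x.
  have [-> //|zx] := eqVneq z x; have [-> //|zy] := eqVneq z y.
  have U3 : uniq [:: x; y; z] by rewrite uniq3 xy ![_ == z]eq_sym zx zy.
  have [_ e1 e2 _ _] := cycle3_c3 U3.
  have: c3 x y z \in P.
    apply: (subsetP sP); rewrite Alt_even odd_permM !odd_tperm.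
    by rewrite xy eq_sym zx.
  by move/PP/(_ _ _ exy); rewrite e1 e2 exy => ->.
by move=> u v; rewrite !fx.
Qed.

Section Commutator.
Variable n : nat.
Implicit Types (s t c : 'S_n).

Lemma is_3cycleP c : reflect (exists x y z, cycle3 c x y z) (is_3cycle c).
Proof.
apply: (iffP idP) => [/existsP[a /existsP[b /existsP[d]]]|[a [b [d [U ca cb cd cf]]]]].
  case/and5P=> ab bd ad /eqP ca /and3P[/eqP cb /eqP cd /forallP cf].
  exists a, b, d; split=> //; first by rewrite uniq3 ab ad bd.
  by move=> u nu; apply/eqP; apply: (implyP (cf u)).
apply/existsP; exists a; apply/existsP; exists b; apply/existsP; exists d.
move: U; rewrite uniq3 => /and3P[-> -> ->]; rewrite ca cb cd !eqxx /=.
by apply/forallP=> u; apply/implyP=> nu; rewrite cf.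
Qed.

Lemma fcommE s t x : fcomm s t (t (s x)) = s (t x).
Proof. by rewrite /fcomm !permM !permK. Qed.

Lemma fcomm_uniq s t c : (forall x, c (t (s x)) = s (t x)) -> fcomm s t = c.
Proof.
move=> h; apply/permP=> u; rewrite -[u](permKV t) -[t^-1 u](permKV s).
by rewrite fcommE h.
Qed.

Lemma potential_fcomm p (f : 'I_n -> 'F_p) a b s t :
  (forall x, f (s x) = f x + a)%R -> (forall x, f (t x) = f x + b)%R ->
  forall x, f (fcomm s t x) = f x.
Proof.
move=> fs ft u; rewrite -[u](permKV t) -[t^-1 u](permKV s) fcommE.
by rewrite !(fs, ft) -!addrA [(a + b)%R]addrC.
Qed.

(** By [Alt_no_blocks] a non-constant potential would be injective, but every potential is invariant
    under the commutator, which moves points. Conversely [rigid_Alt] gives the alternating group,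
    and one odd element then gives all of them. *)
Lemma cAP s t : (s, t) \in cA n <-> is_3cycle (fcomm s t) /\ rigid s t.
Proof.
rewrite inE /=; split=> [/andP[c3 hG]|[/[dup] c3 /is_3cycleP[x [y [z hc]]] rig]].
  split=> // p f a b pr fs ft x y; apply/eqP; rewrite -[_ == _]negbK; apply/negP=> fxy.
  have sA : 'Alt_('I_n) \subset <<[set s; t]>>.
    by case/orP: hG => /eqP->; rewrite ?Alt_subset.
  have inj u v : f u = f v -> u = v.
    move=> fuv; apply/eqP; rewrite -[_ == _]negbK; apply/negP=> uv.
    case/eqP: fxy; apply: (Alt_no_blocks sA _ _ uv fuv) => u' v' e.
      by rewrite !fs e.
    by rewrite !ft e.
  case/is_3cycleP: c3 => u [v [w [U cu _ _ _]]].
  have := potential_fcomm fs ft u; rewrite cu => /inj e.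
  by move: U; rewrite e uniq3 eqxx.
have sA := rigid_Alt hc rig; rewrite c3 /=.
set G := <<_>> in sA *; have [sGA|/subsetPn[g Gg Ag]] := boolP (G \subset 'Alt_('I_n)).
  by rewrite eqEsubset sGA sA.
apply/orP; right; rewrite eqEsubset subsetT /=; apply/subsetP=> h _.
have [hA|hA] := boolP (h \in 'Alt_('I_n)); first by apply: (subsetP sA).
rewrite -[h](mulgKV g) groupM //; apply: (subsetP sA).
by move: Ag hA; rewrite !Alt_even odd_permM odd_permV !negbK => -> ->.
Qed.
End Commutator.

(** * One cylinder *)

Section Orbits.
Variable T : finType.
Implicit Types (s : {perm T}) (x y : T).

Lemma porbit_iter s x k : iter k s x \in porbit s x.
Proof. by rewrite -permX mem_porbit. Qed.

Lemma porbit_gt0 s x : 0 < #|porbit s x|.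
Proof. by rewrite lt0n card_porbit_neq0. Qed.

Lemma porbit_iterP s x y : y \in porbit s x ->
  exists2 k, k < #|porbit s x| & y = iter k s x.
Proof. by rewrite porbit_traject => /trajectP. Qed.

Lemma porbit_iter_inj s x i j : i < #|porbit s x| -> j < #|porbit s x| ->
  iter i s x = iter j s x -> i = j.
Proof.
move=> hi hj e; apply/eqP; have := uniq_traject_porbit s x.
move/(nth_uniq x)=> <-; rewrite ?size_traject // !nth_traject //.
exact/eqP.
Qed.

Lemma porbit_iter_neq s x i j : i < #|porbit s x| -> j < #|porbit s x| ->
  i != j -> iter i s x != iter j s x.
Proof. by move=> hi hj; apply: contra_neq => /porbit_iter_inj; apply. Qed.

Lemma iter_porbit_mod s x k : iter (k %% #|porbit s x|) s x = iter k s x.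
Proof.
rewrite {2}(divn_eq k #|porbit s x|) addnC iterD; congr (iter _ _ _).
elim: (k %/ _) => [//|m IH]; by rewrite mulSn iterD -IH iter_porbit.
Qed.

Lemma iter_porbit_eq s x i j :
  (iter i s x == iter j s x) = (i == j %[mod #|porbit s x|]).
Proof.
rewrite -(iter_porbit_mod s x i) -(iter_porbit_mod s x j).
apply/eqP/eqP => [e|-> //]; apply: porbit_iter_inj e; exact/ltn_pmod/porbit_gt0.
Qed.

Lemma card_porbit_eq s x w : 0 < w -> iter w s x = x ->
  (forall i, 0 < i < w -> iter i s x <> x) -> #|porbit s x| = w.
Proof.
move=> w0 e mn; have := iter_porbit_eq s x w 0; rewrite e eqxx mod0n => /esym dv.
have le : #|porbit s x| <= w by apply: dvdn_leq => //; rewrite /dvdn dv.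
apply/eqP; rewrite eqn_leq le leqNgt; apply/negP=> lt.
by apply: (mn _ _ (iter_porbit s x)); rewrite porbit_gt0.
Qed.

Lemma porbit_ind s x (P : T -> Prop) : P x -> (forall y, P y -> P (s y)) ->
  forall y, y \in porbit s x -> P y.
Proof. by move=> Px Ps y /porbit_iterP[k _ ->]; elim: k => //= k; apply: Ps. Qed.

Lemma porbit_step s x y : (s y \in porbit s x) = (y \in porbit s x).
Proof. by rewrite ![_ \in porbit s x]porbit_sym -{1}[s y]/(iter 1 s y) -permX porbit_perm. Qed.
End Orbits.

Section OneCylinder.
Variables (n : nat) (o : 'I_n).
Hypotheses (o0 : nat_of_ord o = 0) (n1 : 1 < n).
Implicit Types (s t c : 'S_n).

Definition rotn : 'S_n := perm (@ordS_inj n).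
Local Notation s0 := rotn.

Lemma rotnE (x : 'I_n) : s0 x = x.+1 %% n :> nat.
Proof. by rewrite permE. Qed.

Lemma rotnS (x : 'I_n) : x.+1 < n -> s0 x = x.+1 :> nat.
Proof. by move=> h; rewrite rotnE modn_small. Qed.

Lemma rotn_iter (x : 'I_n) : x = iter x s0 o.
Proof.
apply: val_inj => /=; have : x < n by []; elim: (val x) => //= k IH h.
by rewrite rotnS -IH // ltnW.
Qed.

Lemma rotn_porbit x : x \in porbit s0 o.
Proof. by rewrite [x]rotn_iter porbit_iter. Qed.

Definition fullcycle s := [forall x, forall y, x \in porbit s y].

Lemma fullcycleP s x : (forall y, y \in porbit s x) -> fullcycle s.
Proof.
move=> h; apply/forallP=> y; apply/forallP=> z.
by rewrite -eq_porbit_mem (eqP (etrans (eq_porbit_mem _ _ _) (h y))) eq_sym eq_porbit_mem h.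
Qed.

Lemma fullcycle_card s x : fullcycle s -> #|porbit s x| = n.
Proof.
move=> /forallP fs; transitivity #|'I_n|; last exact: card_ord.
apply: eq_card => y; rewrite inE; have /forallP := fs y; apply.
Qed.

Lemma fullcycle_rotn : fullcycle s0.
Proof. by apply: (@fullcycleP _ o) => y; apply: rotn_porbit. Qed.

Lemma fullcycle_coord s P : fullcycle s ->
  exists pi : 'S_n, [/\ pi o = P & forall x, pi (s0 x) = s (pi x)].
Proof.
move=> fs; have cP := fullcycle_card P fs.
have inj : injective (fun x : 'I_n => iter x s P).
  by move=> x y /porbit_iter_inj e; apply/val_inj/e; rewrite cP.
exists (perm inj); split; first by rewrite permE o0.
move=> x; rewrite !(permE inj) rotnE.
by have := iter_porbit_mod s P x.+1; rewrite cP => ->.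
Qed.

Lemma rigidJ s t pi : rigid s t -> rigid (s ^ pi) (t ^ pi).
Proof.
move=> rig p f a b pr fs ft x y.
have := rig p (f \o pi) a b pr _ _ (pi^-1 x) (pi^-1 y); rewrite /= !permKV; apply.
  by move=> z; rewrite -fs permJ.
by move=> z; rewrite -ft permJ.
Qed.

Lemma fcommJ s t pi : fcomm (s ^ pi) (t ^ pi) = fcomm s t ^ pi.
Proof. by rewrite /fcomm !conjMg !conjVg. Qed.

Lemma is_3cycleJ c pi : is_3cycle c -> is_3cycle (c ^ pi).
Proof.
by case/is_3cycleP=> x [y [z h]]; apply/is_3cycleP; exists (pi x), (pi y), (pi z); apply: cycle3J.
Qed.

Lemma cAJ s t pi : (s, t) \in cA n -> (s ^ pi, t ^ pi) \in cA n.
Proof.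
case/cAP=> h3 rig; apply/cAP; split; last exact: rigidJ.
by rewrite fcommJ is_3cycleJ.
Qed.

Lemma card_moved c : is_3cycle c -> #|[set x | c x != x]| = 3.
Proof.
case/is_3cycleP=> x [y [z [U cx cy cz cf]]].
transitivity #|[:: x; y; z]|; last by rewrite (card_uniqP U).
apply: eq_card => u; rewrite inE; apply/idP/idP; first by apply: contraR => /cf ->.
move: U; rewrite uniq3 !inE => /and3P[xy xz yz].
by case/or3P=> /eqP->; rewrite ?cx ?cy ?cz // eq_sym.
Qed.

Definition rotn_partners := [set t | ((s0, t) \in cA n) && (fcomm s0 t o != o)].

(* The factor 3 marks one of the points moved by the commutator; conjugation then
   moves s to rotn and the marked point to o. *)
Lemma card_fullcycle :
  (3 * #|[set st in cA n | fullcycle st.1]| = n`! * #|rotn_partners|)%N.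
Proof.
pose Y := [set q : ('S_n * 'S_n) * 'I_n |
  [&& q.1 \in cA n, fullcycle q.1.1 & fcomm q.1.1 q.1.2 q.2 != q.2]].
have <- : #|Y| = (3 * #|[set st in cA n | fullcycle st.1]|)%N.
  rewrite mulnC -sum_nat_const -sum1_card.
  rewrite (partition_big (fun q => q.1) (mem [set st in cA n | fullcycle st.1])) /=; last first.
    by move=> q; rewrite !inE => /and3P[-> ->].
  apply: eq_bigr => st; rewrite !inE => /andP[/[dup] hA /andP[h3 _] hf].
  rewrite -(card_moved h3) -sum1_card.
  rewrite (reindex_onto (fun x => (st, x)) (fun q => q.2)) /=; last first.
    by case=> q x /= /andP[_ /eqP<-].
  by apply: eq_bigl => x; rewrite !inE !eqxx /= hA hf !andbT.
have -> : (n`! * #|rotn_partners|)%N = #|setX [set: 'S_n] rotn_partners|.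
  by rewrite cardsX cardsT card_Sn.
pose g (q : 'S_n * 'S_n) := ((s0 ^ q.1, q.2 ^ q.1), q.1 o).
have <- : g @: setX setT rotn_partners = Y.
  apply/setP=> -[[s t] P]; apply/imsetP/idP.
    case=> -[pi t']; rewrite !inE /= => /andP[hA mv] [-> -> ->].
    have := cAJ pi (_ : (s0, t') \in cA n); rewrite !inE /= => -> //.
    rewrite fcommJ permJ (inj_eq perm_inj) mv andbT.
    apply: (@fullcycleP _ (pi o)) => y; apply/porbitP.
    have /porbitP[i e] := rotn_porbit (pi^-1 y).
    by exists i; rewrite -conjXg permJ -e permKV.
  rewrite inE /= => /and3P[hA hf mv].
  have [pi [pio pis]] := fullcycle_coord P hf.
  have es : s0 ^ pi = s.
    by apply/permP=> x; rewrite -[x](permKV pi) permJ pis.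
  exists (pi, t ^ pi^-1); last by rewrite /g /= es conjgKV pio.
  rewrite !inE /= -[s0](conjgK pi) es; have := cAJ pi^-1 hA; rewrite !inE => -> /=.
  by rewrite fcommJ -{1}[o](permK pi) permJ pio -[o in X in _ != X](permK pi) pio (inj_eq perm_inj).
rewrite card_in_imset // => -[pi t] [pi' t'] _ _ [e1 e2 e3].
have epi : pi = pi'.
  apply/permP=> x; rewrite [x]rotn_iter; elim: (val x) => //= k IH.
  by rewrite -!(permJ s0) e1 IH.
by rewrite epi in e2 *; congr (_, _); apply: (@conjg_inj _ pi').
Qed.

(** The pair (j, i) stands for the 3-cycle 0 -> i -> j -> 0. The condition j < i fixes its
    orientation: with i < j, [rotn * c^-1] would no longer be a single cycle. *)
Definition tripleset := [set ji : 'I_n * 'I_n |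
  [&& 0 < ji.1, ji.1 < ji.2 & gcdn n (gcdn ji.1 ji.2) == 1%N]].

Lemma rotn_ind (P : 'I_n -> Prop) x : P x -> (forall y, P y -> P (s0 y)) -> forall y, P y.
Proof.
move=> Px Ps y; apply: (porbit_ind Px Ps).
by have /forallP/(_ y)/forallP/(_ x) := fullcycle_rotn.
Qed.

Lemma fcommVE s t c x : fcomm s t = c -> t (s x) = c^-1 (s (t x)).
Proof. by move<-; rewrite -(fcommE s t) permK. Qed.

Lemma rotn_partners_sub t : t \in rotn_partners ->
  (fcomm s0 t (fcomm s0 t o), fcomm s0 t o) \in tripleset.
Proof.
rewrite inE => /andP[/cAP[/is_3cycleP[x [y [z /cycle3_moved h]]] rig] /h{h}].
set c := fcomm s0 t; set i := c o; set j := c i => hc.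
have [U co ci cj cf] := hc; rewrite inE /=.
move: (U); rewrite uniq3 -!val_eqE /= o0 => /and3P[i0 j0 ij].
have i_gt0 : 0 < i by lia.
have j_gt0 : 0 < j by lia.
rewrite j_gt0 /=.
have cVo : c^-1 i = o by rewrite -co permK.
have cVf u : u \notin [:: o; i; j] -> c^-1 u = u by move/cf => e; rewrite -{1}e permK.
apply/andP; split.
  rewrite ltnNge; apply/negP => ltij.
  (* If i < j, then c^-1 s sends i - 1 back to 0 and preserves the interval [0, i). Since [t]
     carries the n-cycle [s0] to c^-1 s, all values of [t] would stay below i. *)
  have inv u : t u < i -> t (s0 u) < i.
    move=> lt; rewrite (@fcommVE s0 t c) //.
    have e : s0 (t u) = (t u).+1 :> nat by apply: rotnS; apply: leq_ltn_trans (ltn_ord i).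
    have [ei|ni] := eqVneq (t u).+1 i.
      have -> : s0 (t u) = i by apply: val_inj; rewrite /= e.
      by rewrite cVo o0.
    have lti : (t u).+1 < i by lia.
    rewrite cVf ?e // !inE !negb_or -!val_eqE /= e o0 /=; lia.
  have := @rotn_ind (fun u => t u < i) (t^-1 o) _ inv (t^-1 i).
  by rewrite !permKV o0 ltnn => /(_ i_gt0).
apply/eqP; set g := gcdn _ _; apply/eqP; rewrite -[_ == _]negbK; apply/negP=> g1.
have g0 : 0 < g by rewrite gcdn_gt0; lia.
have pr : prime (pdiv g) by apply: pdiv_prime; lia.
move: (pdiv g) pr (pdiv_dvd g) => p pr; rewrite !dvdn_gcd => /and3P[pn pj pi].
(* For a common prime divisor p, the residue modulo p is a potential: [s0] adds 1 because p divides
   n, and [c] preserves residues because 0, i and j are all divisible by p. *)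
pose f (x : 'I_n) : 'F_p := (x%:R)%R.
have fs u : f (s0 u) = (f u + 1)%R.
  rewrite /f rotnE -(natrD _ u 1) addn1.
  apply/eqP; rewrite {2}(divn_eq u.+1 n) natrD natrM.
  have /eqP-> : (n%:R == 0 :> 'F_p)%R by rewrite Fp_nat_eq0.
  by rewrite mulr0 add0r.
have fc u : f (c u) = f u.
  have fo : f o = 0%R by rewrite /f o0.
  have fi : f i = 0%R by apply/eqP; rewrite Fp_nat_eq0.
  have fj : f j = 0%R by apply/eqP; rewrite Fp_nat_eq0.
  have [->|uo] := eqVneq u o; first by rewrite co fo.
  have [->|ui] := eqVneq u i; first by rewrite ci fi.
  have [->|uj] := eqVneq u j; first by rewrite cj fj.
  by rewrite cf // !inE !negb_or uo ui uj.
have ft u : f (t u) = (f u + (f (t o) - f o))%R.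
  move: u; apply: (@rotn_ind _ o) => [|u IH]; first by rewrite addrC subrK.
  by rewrite -fc fcommE !fs IH addrAC.
have := rig p f 1%R _ pr fs ft (s0 o) o; rewrite fs -{2}[f o]addr0 => /addrI/eqP.
by rewrite oner_eq0.
Qed.

(* c^-1 s runs through the three arcs [0, j), [i, n), [j, i) in this order. *)
Lemma fullcycle_exchange (i j : 'I_n) : 0 < j -> j < i ->
  fullcycle (s0 * (c3 o i j)^-1).
Proof.
move=> j0 ji; set s' := _ * _.
have U : uniq [:: o; i; j] by rewrite uniq3 -!val_eqE /= o0; lia.
have [_ co ci cj cf] := cycle3_c3 U.
have s'E u : s' u = (c3 o i j)^-1 (s0 u) by rewrite permM.
have cVf u : u \notin [:: o; i; j] -> (c3 o i j)^-1 u = u.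
  by move/cf => e; rewrite -{1}e permK.
have s'S (u v : 'I_n) : u.+1 = v -> nat_of_ord v != i -> nat_of_ord v != j -> s' u = v.
  move=> uv vi vj; have -> : v = s0 u by apply: val_inj; rewrite /= rotnS ?uv.
  rewrite s'E cVf // !inE !negb_or -!val_eqE /= rotnS; last by rewrite uv.
  rewrite o0; lia.
apply: (@fullcycleP _ o).
have seg (a : 'I_n) m : a \in porbit s' o ->
    (forall v : 'I_n, a < v < m -> nat_of_ord v != i /\ nat_of_ord v != j) ->
    forall v : 'I_n, a <= v < m -> v \in porbit s' o.
  move=> ha hm [v ltv] /=; elim: v ltv => [|v IH] ltv /andP[av vm].
    by have -> : Ordinal ltv = a by apply: val_inj => /=; lia.
  have [e|ne] := eqVneq (val a) v.+1.
    by have -> : Ordinal ltv = a by apply: val_inj.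
  have ltv' : v < n by lia.
  have [|vi vj] := hm (Ordinal ltv); first by move=> /=; move: ne av; rewrite /=; lia.
  have <- : s' (Ordinal ltv') = Ordinal ltv by apply: s'S.
  rewrite porbit_step; apply: IH; move: ne av; rewrite /=; lia.
have h1 (v : 'I_n) : v < j -> v \in porbit s' o.
  move=> lt; apply: (seg o j); rewrite ?porbit_id ?o0 //= => u /andP[_ lu]; lia.
have hi : i \in porbit s' o.
  have ltj : j.-1 < n by have := ltn_ord j; lia.
  have -> : i = s' (Ordinal ltj).
    have e : s0 (Ordinal ltj) = j by apply: val_inj; rewrite /= rotnS /= prednK.
    by rewrite s'E e; apply/esym/(canLR (permK _)).
  by rewrite porbit_step h1 //=; lia.
have h2 (v : 'I_n) : i <= v -> v \in porbit s' o.
  move=> le; apply: (seg i n); rewrite ?le //= => u /andP[lu _]; lia.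
have hj : j \in porbit s' o.
  have ltn' : n.-1 < n by lia.
  have -> : j = s' (Ordinal ltn').
    have e : s0 (Ordinal ltn') = o.
      by apply: val_inj; rewrite /= rotnE /= prednK ?modnn //; lia.
    by rewrite s'E e; apply/esym/(canLR (permK _)).
  by rewrite porbit_step h2 //=; have := ltn_ord i; lia.
move=> v; have [lt|le] := ltnP v j; first exact: h1.
have [le'|lt] := leqP i v; first exact: h2.
by apply: (seg j i); rewrite ?le //= => u /andP[lu lu']; lia.
Qed.

(** Given [c], the recursion [t (s0 x) = c^-1 (s0 (t x))] determines [t] from [t o], and [t o] may
    be any of the n points. For rigidity, a potential has f(x) = f(0) + x a, and invariance under
    [c] gives i a = j a = n a = 0. *)
Lemma card_rotn_partners : #|rotn_partners| = (n * #|tripleset|)%N.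
Proof.
have -> : (n * #|tripleset|)%N = #|setX [set: 'I_n] tripleset|.
  by rewrite cardsX cardsT card_ord.
pose g t := (t o, (fcomm s0 t (fcomm s0 t o), fcomm s0 t o)).
have inj : {in rotn_partners &, injective g}.
  move=> t t'; rewrite ![_ \in rotn_partners]inE => /andP[/cAP[/is_3cycleP[x [y [z h]]] _] mv].
  case/andP=> /cAP[/is_3cycleP[x' [y' [z' h']]] _] mv' [et e1 e2].
  have {h} h := cycle3_moved h mv; have {h'} h' := cycle3_moved h' mv'.
  have ec : fcomm s0 t = fcomm s0 t'.
    by apply: (cycle3_inj h); move: h'; rewrite -e1 -e2.
  apply/permP; apply: (@rotn_ind _ o) => // y0 IH.
  by rewrite (@fcommVE s0 t _ _ erefl) (@fcommVE s0 t' _ _ erefl) ec IH.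
rewrite -(card_in_imset inj); apply: eq_card => -[k [j i]].
apply/imsetP/idP => [[t Bt ->]|].
  by rewrite in_setX in_setT rotn_partners_sub.
rewrite in_setX in_setT inE /= => /and3P[j0 ji g1].
have [t [tk ts]] := fullcycle_coord k (fullcycle_exchange j0 ji).
have U : uniq [:: o; i; j] by rewrite uniq3 -!val_eqE /= o0; lia.
have hc := cycle3_c3 U.
have ec : fcomm s0 t = c3 o i j by apply: fcomm_uniq => x; rewrite ts [(s0 * _) _]permM permKV.
have [_ co ci cj cf] := hc.
exists t; last by rewrite /g ec tk co ci.
rewrite inE ec co -val_eqE /= o0; apply/andP; split; last by lia.
apply/cAP; rewrite ec; split; first by apply/is_3cycleP; exists o, i, j.
move=> p f a b pr fs ft.
have fc := potential_fcomm fs ft; rewrite ec in fc.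
have fE m : f (iter m s0 o) = (f o + m%:R * a)%R.
  elim: m => [|m IH] /=; first by rewrite mul0r addr0.
  by rewrite fs IH -(natr1 m) mulrDl mul1r addrA.
have a0 m : f (iter m s0 o) = f o -> (m%:R * a = 0)%R.
  by rewrite fE -{2}[f o]addr0 => /addrI.
have ai : ((i : nat)%:R * a = 0)%R by apply: a0; rewrite -rotn_iter -co fc.
have aj : ((j : nat)%:R * a = 0)%R by apply: a0; rewrite -rotn_iter -cj fc.
have an : (n%:R * a = 0)%R.
  by apply: a0; have := iter_porbit s0 o; rewrite (fullcycle_card _ fullcycle_rotn) => ->.
have {}a0 : a = 0%R.
  apply/eqP; rewrite -[_ == _]negbK; apply/negP=> nza.
  have dv m : (m%:R * a = 0)%R -> p %| m.
    by move/eqP; rewrite mulf_eq0 (negPf nza) orbF Fp_nat_eq0.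
  have : p %| gcdn n (gcdn j i) by rewrite !dvdn_gcd !dv.
  by rewrite (eqP g1) dvdn1 => /eqP e; rewrite e in pr.
have f0 x : f x = f o by rewrite [x]rotn_iter fE a0 mulr0 addr0.
by move=> x y; rewrite !f0.
Qed.
End OneCylinder.

(** * Two cylinders *)

Section Swaps.
Variables (T : finType) (s : {perm T}) (b1 b2 : T).

Fixpoint swaps m : {perm T} :=
  if m is m'.+1 then tperm (iter m' s b1) (iter m' s b2) * swaps m' else 1.

Definition rho := swaps #|porbit s b1|.

Hypothesis nb : b2 \notin porbit s b1.

Lemma iter_neq i j : iter i s b1 != iter j s b2.
Proof.
apply: contraNneq nb => e.
have := porbit_iter s b1 i; rewrite e -eq_porbit_mem -permX porbit_perm.
by rewrite eq_porbit_mem.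
Qed.

Lemma swapsD m x : (forall k, k < m -> x != iter k s b1) ->
  (forall k, k < m -> x != iter k s b2) -> swaps m x = x.
Proof.
elim: m => [|m IH] h1 h2 /=; first by rewrite perm1.
rewrite permM tpermD; [apply: IH| |].
- by move=> k hk; apply/h1/ltnW.
- by move=> k hk; apply/h2/ltnW.
- by rewrite eq_sym h1.
by rewrite eq_sym h2.
Qed.

Lemma swapsL m k : m <= #|porbit s b1| -> m <= #|porbit s b2| -> k < m ->
  swaps m (iter k s b1) = iter k s b2.
Proof.
elim: m => [|m IH] // m1 m2; rewrite ltnS leq_eqVlt => /predU1P[->|km] /=; rewrite permM.
  rewrite tpermL swapsD // => j jm; first by rewrite eq_sym iter_neq.
  by apply: porbit_iter_neq; lia.
rewrite tpermD ?IH // ?(ltnW m1) ?(ltnW m2) // 1?eq_sym ?iter_neq //.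
by apply: porbit_iter_neq; lia.
Qed.

Lemma swapsR m k : m <= #|porbit s b1| -> m <= #|porbit s b2| -> k < m ->
  swaps m (iter k s b2) = iter k s b1.
Proof.
elim: m => [|m IH] // m1 m2; rewrite ltnS leq_eqVlt => /predU1P[->|km] /=; rewrite permM.
  rewrite tpermR swapsD // => j jm; last by rewrite iter_neq.
  by apply: porbit_iter_neq; lia.
rewrite tpermD ?IH // ?(ltnW m1) ?(ltnW m2) // ?iter_neq //.
by apply: porbit_iter_neq; lia.
Qed.

Hypothesis ltw : #|porbit s b1| < #|porbit s b2|.
Local Notation w1 := #|porbit s b1|.
Local Notation w2 := #|porbit s b2|.

Lemma rhoL k : k < w1 -> rho (iter k s b1) = iter k s b2.
Proof. by move=> h; apply: swapsL => //; apply: ltnW. Qed.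

Lemma rhoR k : k < w1 -> rho (iter k s b2) = iter k s b1.
Proof. by move=> h; apply: swapsR => //; apply: ltnW. Qed.

Lemma rhoD k : w1 <= k < w2 -> rho (iter k s b2) = iter k s b2.
Proof.
move=> /andP[h1 h2]; apply: swapsD => j hj; first by rewrite eq_sym iter_neq.
by apply: porbit_iter_neq; lia.
Qed.

Lemma rho_out x : x \notin porbit s b1 -> x \notin porbit s b2 -> rho x = x.
Proof.
by move=> h1 h2; apply: swapsD => k _; [apply: contraNneq h1 | apply: contraNneq h2] => ->;
  apply: porbit_iter.
Qed.

Lemma uniq_rho : uniq [:: b2; iter w1 s b2; b1].
Proof.
rewrite uniq3 -{1 3}[b2]/(iter 0 s b2) -{2 4}[b1]/(iter 0 s b1).
rewrite ![_ == iter 0 s b1]eq_sym !iter_neq !andbT.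
by rewrite iter_porbit_eq mod0n modn_small // eq_sym -lt0n porbit_gt0.
Qed.

(** [rho] commutes with [s] except at the points preceding [b1], [b2] and [iter w1 s b2], where the
    narrow cycle closes up, the wide cycle closes up, or the exchanged stretch ends. These three
    defects are the three values of the 3-cycle. *)
Lemma rho_comm x : c3 b2 (iter w1 s b2) b1 (rho (s x)) = s (rho x).
Proof.
have [_ c1 c2 c3e cf] := cycle3_c3 uniq_rho; set c := c3 _ _ _ in c1 c2 c3e cf *.
have cf2 k : 0 < k < w2 -> k <> w1 -> c (iter k s b2) = iter k s b2.
  move=> /andP[k0 k2] kw; apply: cf; rewrite !inE !negb_or.
  apply/and3P; split; last by rewrite eq_sym -[b1]/(iter 0 s b1) iter_neq.
    by apply: (@porbit_iter_neq _ s b2 k 0); lia.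
  by apply: porbit_iter_neq; lia.
have cf1 k : 0 < k < w1 -> c (iter k s b1) = iter k s b1.
  move=> /andP[k0 k1]; apply: cf; rewrite !inE !negb_or iter_neq.
  apply/andP; split; first by rewrite -[b2]/(iter 0 s b2) iter_neq.
  by apply: (@porbit_iter_neq _ s b1 k 0); lia.
have [/porbit_iterP[k kw ->]|n1] := boolP (x \in porbit s b1).
  rewrite (rhoL kw) -!iterS; have [e|ne] := eqVneq k.+1 w1.
    by rewrite e iter_porbit -[b1 in rho b1]/(iter 0 s b1) rhoL ?porbit_gt0.
  have lt : k.+1 < w1 by lia.
  by rewrite rhoL ?cf2 //; lia.
have [/porbit_iterP[k kw ->]|n2] := boolP (x \in porbit s b2); last first.
  rewrite !rho_out ?porbit_step //; apply: cf; rewrite !inE !negb_or; apply/and3P; split.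
  - by apply: contraNneq n2 => e; rewrite -(porbit_step s) e porbit_id.
  - by apply: contraNneq n2 => e; rewrite -(porbit_step s) e porbit_iter.
  by apply: contraNneq n1 => e; rewrite -(porbit_step s) e porbit_id.
rewrite -iterS; have [k1|k1] := ltnP k w1.
  rewrite (rhoR k1) -!iterS; have [e|ne] := eqVneq k.+1 w1.
    by rewrite e rhoD ?leqnn // c2 iter_porbit.
  have lt : k.+1 < w1 by lia.
  by rewrite rhoR ?cf1 //; lia.
rewrite (rhoD (k := k)) ?k1 // -!iterS; have [e|ne] := eqVneq k.+1 w2.
  by rewrite e iter_porbit -[b2 in rho b2]/(iter 0 s b2) rhoR ?porbit_gt0.
by rewrite rhoD ?cf2 //; lia.
Qed.
End Swaps.

(** * Cycle lengths of [s] compared with those of [s * c^-1] *)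

Section Deformation.
Variables (T : finType) (s c t : {perm T}).
Hypothesis ct : forall v, c (t (s v)) = s (t v).
Local Notation s' := (s * c^-1).

Lemma deformE v : s' v = c^-1 (s v). Proof. by rewrite permM. Qed.

Lemma deform_conj v : t (s v) = s' (t v).
Proof. by rewrite deformE -ct permK. Qed.

Lemma deform_conj_iter k v : t (iter k s v) = iter k s' (t v).
Proof. by elim: k => //= k IH; rewrite deform_conj IH. Qed.

Lemma deform_card_porbit v : #|porbit s' (t v)| = #|porbit s v|.
Proof.
apply: card_porbit_eq; first exact: porbit_gt0.
  by rewrite -deform_conj_iter iter_porbit.
move=> i /andP[i0 iw]; rewrite -deform_conj_iter => /perm_inj.
by apply/eqP/(@porbit_iter_neq _ s v i 0); lia.
Qed.

Lemma deform_count k : #|[set v | #|porbit s v| == k]| = #|[set v | #|porbit s' v| == k]|.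
Proof.
rewrite -(card_imset _ (@perm_inj _ t)); apply: eq_card => v; apply/imsetP/idP.
  by case=> u; rewrite !inE => h ->; rewrite deform_card_porbit.
by rewrite inE => h; exists (t^-1 v); rewrite ?permKV // inE -deform_card_porbit permKV.
Qed.

Variables x y z : T.
Hypothesis hc : cycle3 c x y z.

Lemma cycle3V_fix u : u \notin [:: x; y; z] -> c^-1 u = u.
Proof. by case: hc => _ _ _ _ cf /cf e; rewrite -{1}e permK. Qed.

Lemma cycle3V_x : c^-1 x = z. Proof. by case: hc => _ _ _ <- _; rewrite permK. Qed.
Lemma cycle3V_y : c^-1 y = x. Proof. by case: hc => _ <- _ _ _; rewrite permK. Qed.

Lemma deform_iter k : (forall i, 0 < i < k -> iter i s x \notin [:: x; y; z]) ->
  forall i, i < k -> iter i s' x = iter i s x.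
Proof.
move=> h; elim=> [|i IH] //= lt; rewrite IH; last by apply: ltnW.
by rewrite deformE -iterS cycle3V_fix // h // lt.
Qed.

Lemma deform_out v : v \notin porbit s x -> v \notin porbit s y -> v \notin porbit s z ->
  #|porbit s' v| = #|porbit s v|.
Proof.
move=> vx vy vz.
have e k : iter k s' v = iter k s v.
  elim: k => //= k IH; rewrite IH deformE -iterS cycle3V_fix // !inE !negb_or; apply/and3P.
  by split; [apply: contraNneq vx|apply: contraNneq vy|apply: contraNneq vz] => <-;
     rewrite porbit_sym porbit_iter.
apply: card_porbit_eq; first exact: porbit_gt0.
  by rewrite e iter_porbit.
move=> i iw; rewrite e.
by apply/eqP/(@porbit_iter_neq _ s v i 0); lia.
Qed.

Lemma iter_neq_orbit u i : u \notin porbit s x -> iter i s x != u.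
Proof. by apply: contraNneq => <-; apply: porbit_iter. Qed.

(** Starting from [x], the iterates of [s * c^-1] follow the [s]-orbit of [x] until it would close
    up; there c^-1 replaces [x] by [z], so the orbit continues into that of [z]. *)
Lemma deform_merge : y \notin porbit s x -> z \notin porbit s x ->
  (forall v, v \in porbit s x -> v \in porbit s' x) /\ z \in porbit s' x.
Proof.
move=> yx zx.
have h i : 0 < i < #|porbit s x| -> iter i s x \notin [:: x; y; z].
  move=> iw; rewrite !inE !negb_or; rewrite (iter_neq_orbit _ yx) (iter_neq_orbit _ zx) !andbT.
  by apply: (@porbit_iter_neq _ s x i 0); lia.
split=> [v /porbit_iterP[k kw ->]|]; first by rewrite -(deform_iter h) ?porbit_iter.
have w0 := porbit_gt0 s x.
have <- : iter #|porbit s x| s' x = z; last exact: porbit_iter.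
rewrite -(prednK w0) iterS (deform_iter h) ?prednK // deformE -iterS prednK //.
by rewrite iter_porbit cycle3V_x.
Qed.

(* Outside the s-orbits of x and z nothing changes, while x acquires order k under
   s c^-1; as both permutations have equally many points of order k, some point of
   these two orbits has s-order k, and it lies in the orbit of z. *)
Lemma deform_split k : 0 < k < #|porbit s x| -> y = iter k s x -> z \notin porbit s x ->
  k = #|porbit s z|.
Proof.
move=> /andP[k0 kw] ey zx.
have h i : 0 < i < k -> iter i s x \notin [:: x; y; z].
  move=> iw; rewrite !inE !negb_or; rewrite (iter_neq_orbit _ zx) andbT ey.
  apply/andP; split; last by apply: porbit_iter_neq; lia.
  by apply: (@porbit_iter_neq _ s x i 0); lia.
have ox : #|porbit s' x| = k.
  apply: card_porbit_eq => //.
    rewrite -(prednK k0) iterS (deform_iter h) ?prednK // deformE -iterS prednK //.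
    by rewrite -ey cycle3V_y.
  move=> i ik; rewrite (deform_iter h); last by case/andP: ik.
  by apply/eqP/(@porbit_iter_neq _ s x i 0); lia.
apply/eqP; rewrite eq_sym -[_ == _]negbK; apply/negP=> ne.
have yx : porbit s y = porbit s x by rewrite ey -permX porbit_perm.
have := deform_count k; apply/eqP; rewrite neq_ltn; apply/orP; left.
apply: proper_card; apply/properP; split.
  apply/subsetP=> v; rewrite !inE => /eqP ov.
  have vx : v \notin porbit s x.
    by apply/negP; rewrite -eq_porbit_mem => /eqP e; move: kw; rewrite -ov e ltnn.
  rewrite deform_out ?yx ?ov //.
  by apply/negP; rewrite -eq_porbit_mem => /eqP e; move: ne; rewrite -ov e eqxx.
by exists x; rewrite !inE ?ox //; move: kw; rewrite ltn_neqAle eq_sym => /andP[].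
Qed.
End Deformation.

(* Otherwise s c^-1 would merge the three orbits into one. *)
Lemma deform_not_distinct (T : finType) (s c t : {perm T}) x y z :
    (forall v, c (t (s v)) = s (t v)) -> cycle3 c x y z ->
  y \notin porbit s x -> z \notin porbit s x -> z \notin porbit s y -> False.
Proof.
move=> ct hc yx zx zy.
have [h1 h1'] := deform_merge hc yx zx.
have [h2 h2'] : (forall v, v \in porbit s y -> v \in porbit (s * c^-1) y)
    /\ x \in porbit (s * c^-1) y.
  by apply: (deform_merge (cycle3_rot hc)); rewrite // porbit_sym.
have [h3 h3'] : (forall v, v \in porbit s z -> v \in porbit (s * c^-1) z)
    /\ y \in porbit (s * c^-1) z.
  by apply: (deform_merge (cycle3_rot (cycle3_rot hc))); rewrite porbit_sym.
set s' := s * c^-1 in h1 h1' h2 h2' h3 h3'.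
have e1 : porbit s' x = porbit s' y by apply/eqP; rewrite eq_porbit_mem.
have e2 : porbit s' z = porbit s' x by apply/eqP; rewrite eq_porbit_mem.
have := deform_count ct #|porbit s x|; apply/eqP; rewrite neq_ltn; apply/orP; right.
have gt : #|porbit s x| < #|porbit s' x|.
  apply: proper_card; apply/properP; split; first by apply/subsetP.
  by exists z.
have big v : porbit s' v = porbit s' x -> (#|porbit s' v| == #|porbit s x|) = false.
  by move=> ->; rewrite gtn_eqF.
apply: proper_card; apply/properP; split.
  apply/subsetP=> v; rewrite !inE => ov.
  rewrite -(deform_out hc) //; apply/negP.
  - by move/h1; rewrite -eq_porbit_mem => /eqP/big; rewrite ov.
  - by move/h2; rewrite -eq_porbit_mem -e1 => /eqP/big; rewrite ov.
  by move/h3; rewrite -eq_porbit_mem e2 => /eqP/big; rewrite ov.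
by exists x; rewrite !inE ?eqxx // big.
Qed.

Section TwoCylinders.
Variable n : nat.
Implicit Types (s t u c : 'S_n).

(* (s, u, b1, b2) encodes the pair (s, rho o u); b1 and b2 are the base points of the
   narrow and of the wide cylinder. *)
Definition two_cyl := [set q : ('S_n * 'S_n) * ('I_n * 'I_n) |
  [&& q.1.1 * q.1.2 == q.1.2 * q.1.1, #|porbit q.1.1 q.2.1| < #|porbit q.1.1 q.2.2|
    & (q.1.1, q.1.2 * rho q.1.1 q.2.1 q.2.2) \in cA n]].

Lemma rho_notin s (b1 b2 : 'I_n) : #|porbit s b1| < #|porbit s b2| -> b2 \notin porbit s b1.
Proof.
by move=> lt; apply/negP; rewrite -eq_porbit_mem => /eqP e; rewrite e ltnn in lt.
Qed.

Lemma fcomm_rho s u b1 b2 : s * u = u * s -> #|porbit s b1| < #|porbit s b2| ->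
  fcomm s (u * rho s b1 b2) = c3 b2 (iter #|porbit s b1| s b2) b1.
Proof.
move=> su lt; apply: fcomm_uniq => x; rewrite !(permM u) -(permM s u) su (permM u s).
by rewrite rho_comm // rho_notin.
Qed.

(** The commutator remembers the base points: [b1] is the one point of its support that is alone on
    its [s]-cycle, and [b2] is the image of [b1]. Then [rho] is known and can be divided out. *)
Lemma two_cyl_inj : {in two_cyl &, injective (fun q => (q.1.1, q.1.2 * rho q.1.1 q.2.1 q.2.2))}.
Proof.
move=> [[s u] [b1 b2]] [[s' u'] [b1' b2']]; rewrite ![_ \in two_cyl]inE /=.
case/and3P=> /eqP su lt _ /and3P[/eqP su' lt' _] [es et]; subst s'.
have nb := rho_notin lt; have nb' := rho_notin lt'.
have ec := fcomm_rho su lt; rewrite et (fcomm_rho su' lt') in ec.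
have [_ c1 c2 ce cf] := cycle3_c3 (uniq_rho nb lt); rewrite -ec in c1 c2 ce cf.
have [U' d1 d2 de df] := cycle3_c3 (uniq_rho nb' lt').
move: (c3 b2' _ b1') c1 c2 ce cf d1 d2 de df {ec} => d c1 c2 ce cf d1 d2 de df.
have oi i b : porbit s (iter i s b) = porbit s b by rewrite -permX porbit_perm.
have nb'' : b1' \notin porbit s b2' by rewrite porbit_sym.
have eb1 : b1' = b1.
  have: b1' \in [:: b2; iter #|porbit s b1| s b2; b1].
    apply: contraT => /cf; rewrite de => e; move: U'; rewrite uniq3 e eqxx /=.
    by rewrite andbF.
  rewrite !inE => /or3P[] /eqP e; last by [].
    move: nb'; rewrite -de e c1 -eq_porbit_mem oi eqxx //.
  have eb : b1 = b2' by rewrite -de e c2.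
  have e' : b2 = iter #|porbit s b1'| s b2' by rewrite -ce eb d1.
  by move: nb''; rewrite e -eq_porbit_mem oi e' oi eqxx.
have eb2 : b2' = b2 by move: de; rewrite eb1 ce.
by move: et; rewrite eb1 eb2 => /mulIg ->.
Qed.

(** Here [c] preserves each [s]-orbit, so [t], which carries [s] to c^-1 s, sends [s]-orbits into
    [s]-orbits. They are then blocks, and [Alt_no_blocks] leaves only one. *)
Lemma cA_not_same_orbit s t x y z : (s, t) \in cA n -> cycle3 (fcomm s t) x y z ->
  y \in porbit s x -> z \in porbit s x -> fullcycle s.
Proof.
rewrite inE /= => /andP[_ hG] hc yx zx.
have sA : 'Alt_('I_n) \subset <<[set s; t]>>.
  by case/orP: hG => /eqP->; rewrite ?Alt_subset.
(* Two distinct points in one block are needed. They exist because [s = 1] would make the commutator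
   trivial. *)
have [a na] : exists a, s a != a.
  apply/existsP; apply: contraT; rewrite negb_exists => /forallP h.
  have s1 v : s v = v by apply/eqP; have := h v; rewrite negbK.
  case: hc => U cx _ _ _; move: U; rewrite uniq3 -cx.
  by have := fcommE s t (t^-1 x); rewrite !s1 permKV => ->; rewrite eqxx.
have oc v : porbit s (fcomm s t v) = porbit s v.
  have ey : porbit s y = porbit s x by apply/eqP; rewrite eq_porbit_mem.
  have ez : porbit s z = porbit s x by apply/eqP; rewrite eq_porbit_mem.
  case: hc => U cx cy cz cf.
  have [->|vx] := eqVneq v x; first by rewrite cx.
  have [->|vy] := eqVneq v y; first by rewrite cy ez.
  have [->|vz] := eqVneq v z; first by rewrite cz.
  by rewrite cf // !inE !negb_or vx vy vz.
have os v : porbit s (s v) = porbit s v by apply/eqP; rewrite eq_porbit_mem porbit_step porbit_id.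
apply: (@fullcycleP _ _ a) => v; rewrite -eq_porbit_mem; apply/eqP.
apply: (Alt_no_blocks sA _ _ na (os a)) => {}v w e; first by rewrite !os.
have ot v' : porbit s (t (s v')) = porbit s (t v') by rewrite -oc fcommE os.
have /porbit_iterP[k _ ->] : w \in porbit s v by rewrite -eq_porbit_mem e.
by elim: k => //= k ->; rewrite ot.
Qed.

(** By [deform_split] the gap from [x] to [y] is the length of the cycle of [z], so [c] is exactly
    the 3-cycle of [rho s z x]. Two permutations with the same commutator with [s] differ by an
    element commuting with [s]. *)
Lemma two_cyl_surj s t x y z : (s, t) \in cA n -> cycle3 (fcomm s t) x y z ->
    y \in porbit s x -> z \notin porbit s x ->
  exists2 q, q \in two_cyl & (s, t) = (q.1.1, q.1.2 * rho q.1.1 q.2.1 q.2.2).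
Proof.
move=> hA hc yx zx; have ct := fcommE s t.
have [k kw ey] := porbit_iterP yx.
have k0 : 0 < k.
  by case: k kw ey => // _ ey; case: hc; rewrite uniq3 ey eqxx.
have ek : k = #|porbit s z| by apply: deform_split ct _ _ _ hc _ _ _ _; rewrite ?k0.
have lt : #|porbit s z| < #|porbit s x| by rewrite -ek.
have xz : x \notin porbit s z by rewrite porbit_sym.
have ec : fcomm s t = c3 x (iter #|porbit s z| s x) z.
  by rewrite -ek -ey; apply: cycle3_eq.
pose r := rho s z x.
exists ((s, t * r^-1), (z, x)); last by rewrite /= -/r mulgKV.
rewrite inE /= -/r lt mulgKV hA !andbT; apply/eqP/permP=> v.
rewrite !permM; apply: (@perm_inj _ r); rewrite permKV.
have := rho_comm xz lt (r^-1 (t v)); rewrite -/r permKV -ec -ct.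
by move/perm_inj->.
Qed.

Lemma card_not_fullcycle : #|[set st in cA n | ~~ fullcycle st.1]| = #|two_cyl|.
Proof.
rewrite -(card_in_imset two_cyl_inj); apply: eq_card => -[s t]; apply/idP/imsetP.
  rewrite inE => /andP[hA nf]; have [/is_3cycleP[x [y [z hc]]] _] := (cAP s t).1 hA.
  have hc2 := cycle3_rot hc; have hc3 := cycle3_rot hc2.
  have [yx|yx] := boolP (y \in porbit s x).
    have [zx|zx] := boolP (z \in porbit s x).
      by rewrite (cA_not_same_orbit hA hc yx zx) in nf.
    exact: two_cyl_surj hA hc yx zx.
  have [zx|zx] := boolP (z \in porbit s x).
    apply: (two_cyl_surj hA hc3); first by rewrite porbit_sym.
    have -> : porbit s z = porbit s x by apply/eqP; rewrite eq_porbit_mem.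
    exact: yx.
  have [zy|zy] := boolP (z \in porbit s y).
    by apply: (two_cyl_surj hA hc2) => //; rewrite porbit_sym.
  by case: (deform_not_distinct (fcommE s t) hc yx zx zy).
case=> -[[s' u] [b1 b2]]; rewrite [_ \in two_cyl]inE /= => /and3P[_ lt hA] [-> ->].
rewrite inE hA /=; apply/negP=> fs.
by rewrite !(fullcycle_card _ fs) ltnn in lt.
Qed.
End TwoCylinders.

(** * Torus coordinates for commuting permutations *)

Section TorusModel.
Variables (w h : nat).
Implicit Types z : 'I_w * 'I_h.

Definition torS z := (ordS z.1, z.2).
(* Leaving the top row, one re-enters the bottom row shifted by tau. *)
Definition torU tau z := ((if z.2.+1 == h then iter tau (@ordS w) z.1 else z.1), ordS z.2).

Lemma iter_ordS_val k m (x : 'I_m) : iter k (@ordS m) x = (x + k) %% m :> nat.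
Proof.
elim: k => [|k IH] /=; first by rewrite addn0 modn_small.
by rewrite IH -addn1 modnDml addn1 addnS.
Qed.

Lemma torS_inj : injective torS.
Proof.
move=> [x y] [x' y'] e; have /= e1 := congr1 fst e; have /= e2 := congr1 snd e.
by rewrite e2 (ordS_inj e1).
Qed.

Lemma iter_ordS_inj k m : injective (iter k (@ordS m)).
Proof. by elim: k => //= k IH x y /ordS_inj/IH. Qed.

Lemma torU_inj tau : injective (torU tau).
Proof.
move=> [x y] [x' y'] e; have /= e1 := congr1 fst e; have /= /ordS_inj e2 := congr1 snd e.
by rewrite {}e2 in e1 *; move: e1; case: ifP => _ => [/iter_ordS_inj|] ->.
Qed.

Lemma torSU tau z : torS (torU tau z) = torU tau (torS z).
Proof. by case: z => x y; rewrite /torS /torU /=; case: ifP => _ //; rewrite -iterSr. Qed.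

Lemma iter_torS k z : iter k torS z = (iter k (@ordS w) z.1, z.2).
Proof. by elim: k => [|k IH]; [case: z | rewrite iterS IH]. Qed.

Lemma torU_small tau z (lt : z.2.+1 < h) : torU tau z = (z.1, Ordinal lt).
Proof.
rewrite /torU ltn_eqF //; congr (_, _); apply: val_inj => /=; exact: modn_small.
Qed.

Lemma iter_torU tau k (x : 'I_w) (h0 : 0 < h) (kh : k < h) :
  iter k (torU tau) (x, Ordinal h0) = (x, Ordinal kh).
Proof.
elim: k kh => [|k IH] kh /=; first by congr (_, _); apply: val_inj.
by rewrite (IH (ltnW kh)) torU_small; congr (_, _); apply: val_inj.
Qed.

Lemma iter_torU_last tau (x : 'I_w) (h0 : 0 < h) :
  iter h (torU tau) (x, Ordinal h0) = (iter tau (@ordS w) x, Ordinal h0).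
Proof.
have lt : h.-1 < h by rewrite prednK.
transitivity (iter h.-1.+1 (torU tau) (x, Ordinal h0)); first by rewrite prednK.
rewrite iterS (iter_torU _ _ _ lt) /torU /= prednK // eqxx.
by congr (_, _); apply: val_inj => /=; rewrite prednK // modnn.
Qed.
End TorusModel.

Section Torus.
Variables (T : finType) (s u : {perm T}).

Lemma height_exists b : exists h, (0 < h) && (iter h u b \in porbit s b).
Proof.
by exists #|porbit u b|; rewrite porbit_gt0 iter_porbit porbit_id.
Qed.

Definition height b := ex_minn (height_exists b).
Lemma heightP b : [/\ 0 < height b, iter (height b) u b \in porbit s b
  & forall m, 0 < m -> iter m u b \in porbit s b -> height b <= m].
Proof.
rewrite /height; case: ex_minnP => m /andP[m0 hm] mn; split=> // k k0 hk.
by apply: mn; rewrite k0.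
Qed.

(** The horizontal offset at the first return of [u] to the row of [b], the row being listed from
    [b] onwards. *)
Definition twist b := index (iter (height b) u b) (traject s b #|porbit s b|).

Definition chart w h tau (phi : 'I_w * 'I_h -> T) :=
  [/\ injective phi, forall z, s (phi z) = phi (torS z)
    & forall z, u (phi z) = phi (torU tau z)].

Section ChartFacts.
Variables (w h tau : nat) (phi : 'I_w * 'I_h -> T).
Hypothesis ch : chart tau phi.
Hypotheses (w0 : 0 < w) (h0 : 0 < h).
Let b := phi (Ordinal w0, Ordinal h0).

Lemma chart_iterS k z : iter k s (phi z) = phi (iter k (@torS w h) z).
Proof. by case: ch => _ hs _; elim: k => //= k ->; rewrite hs. Qed.

Lemma chart_iterU k z : iter k u (phi z) = phi (iter k (@torU w h tau) z).
Proof. by case: ch => _ _ hu; elim: k => //= k ->; rewrite hu. Qed.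

Lemma chart_iterSb k y : iter k s (phi (Ordinal w0, y)) = phi (Ordinal (ltn_pmod k w0), y).
Proof.
rewrite chart_iterS iter_torS; congr (phi (_, _)); apply: val_inj.
by rewrite /= iter_ordS_val.
Qed.

Lemma chart_width : #|porbit s b| = w.
Proof.
have [inj _ _] := ch; apply: card_porbit_eq => //.
  by rewrite chart_iterSb; congr (phi (_, _)); apply: val_inj; rewrite /= modnn.
move=> i iw; rewrite chart_iterSb => /inj e; have /(congr1 val) /= := congr1 fst e.
by rewrite modn_small; lia.
Qed.

Lemma chart_porbit z : (phi z \in porbit s b) = (z.2 == 0 :> nat).
Proof.
have [inj _ _] := ch; apply/idP/idP.
  case/porbit_iterP=> k _; rewrite chart_iterSb => /inj e; by rewrite e.
move=> /eqP z2; have -> : phi z = iter z.1 s b; last exact: porbit_iter.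
rewrite chart_iterSb; congr phi; case: z z2 => x y /= y0; congr (_, _); apply: val_inj => //=.
by rewrite modn_small.
Qed.

Lemma chart_height : height b = h.
Proof.
have [m0 hm mn] := heightP b; move: (height b) m0 hm mn => m m0 hm mn.
apply/eqP; rewrite eqn_leq mn ?h0 //=; last by rewrite chart_iterU iter_torU_last chart_porbit.
rewrite leqNgt; apply/negP=> lt; move: hm.
by rewrite chart_iterU (iter_torU _ _ _ lt) chart_porbit /= eqn0Ngt m0.
Qed.

Lemma chart_height_iter : iter h u b = iter tau s b.
Proof.
by rewrite chart_iterU iter_torU_last chart_iterS iter_torS.
Qed.

Lemma chart_twist : tau < w -> twist b = tau.
Proof.
move=> tauw; rewrite /twist chart_height chart_height_iter.
rewrite -(nth_traject _ (_ : tau < #|porbit s b|)).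
  by rewrite index_uniq ?size_traject ?uniq_traject_porbit ?chart_width.
by rewrite chart_width.
Qed.

Lemma chartE z : phi z = iter z.2 u (iter z.1 s b).
Proof.
case: z => x y /=; rewrite chart_iterSb chart_iterU (iter_torU _ _ _ (ltn_ord y)).
by congr (phi (_, _)); apply: val_inj => //=; rewrite modn_small.
Qed.
End ChartFacts.

Lemma iter_comm (f g : T -> T) : (forall v, f (g v) = g (f v)) ->
  forall i j v, iter i f (iter j g v) = iter j g (iter i f v).
Proof.
move=> fg i j v; elim: i => //= i ->; elim: j => //= j <-; exact: fg.
Qed.

(** Minimality of the height makes the rows [iter y u] of the orbit of [b] pairwise disjoint, and
    the twist records how the last row is glued to the first. *)
Lemma chart_exists b : s * u = u * s ->
  chart (twist b) (fun z : 'I_(#|porbit s b|) * 'I_(height b) => iter z.2 u (iter z.1 s b)).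
Proof.
move=> su; have suv v : s (u v) = u (s v) by rewrite -!permM su.
have cmm := iter_comm suv; have cmm' i j v := esym (cmm i j v).
rewrite /twist; case: (heightP b); move: (height b) => m m0 hm mn.
have hx x y : iter x s b \in porbit s (iter y u b) -> iter y u b \in porbit s b.
  by rewrite -!eq_porbit_mem -(permX s b x) porbit_perm eq_sym.
have wlg (x x' : nat) y y' : y <= y' -> y' < m ->
   iter y u (iter x s b) = iter y' u (iter x' s b) -> y = y' /\ iter x s b = iter x' s b.
  move=> le lt; rewrite -(subnKC le) iterD => e.
  have inj : injective (iter y u) by elim: (y) => //= k IH v v' /perm_inj/IH.
  move/inj: e; rewrite -cmm => e.
  have hin : iter (y' - y) u b \in porbit s b.
    by apply: (hx x); rewrite e porbit_iter.
  have d0 : y' - y = 0.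
    apply/eqP; rewrite eqn0Ngt; apply/negP=> gt0.
    by have := mn _ gt0 hin; lia.
  by split; [lia | rewrite e d0].
split.
- move=> [x y] [x' y'] /= e.
  have [ey ex] : y = y' :> nat /\ iter x s b = iter x' s b.
    have [le|/ltnW le] := leqP y y'; first exact: wlg.
    by have [-> ->] := wlg _ _ _ _ le (ltn_ord y) (esym e).
  congr (_, _); apply: val_inj => //; apply: porbit_iter_inj ex; exact: ltn_ord.
- move=> [x y] /=; rewrite -[s _]/(iter 1 s _) cmm; congr (iter _ _ _).
  by rewrite iter_porbit_mod.
move=> [x y] /=; have [e|ne] := eqVneq y.+1 m.
  have -> : y.+1 %% m = 0 by rewrite e modnn.
  rewrite /= -iterS e iter_ordS_val iter_porbit_mod -cmm iterD; congr (iter _ _ _).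
  have [k kw ek] := porbit_iterP hm.
  by rewrite ek -(nth_traject _ kw) index_uniq ?nth_traject ?size_traject ?uniq_traject_porbit.
by rewrite modn_small // ltn_neqAle ne ltn_ord.
Qed.

Lemma twist_lt b : twist b < #|porbit s b|.
Proof.
rewrite /twist -{2}(size_traject s b #|porbit s b|) index_mem -porbit_traject.
by case: (heightP b).
Qed.

Lemma height_gt0 b : 0 < height b.
Proof. by case: (heightP b). Qed.
End Torus.

(* (gcdn w1 w2).-1 * h2 * t1 stands for - h2 * t1 modulo gcdn w1 w2. *)
Definition goodtwist w1 w2 h1 h2 t1 t2 :=
  coprime h1 h2 && coprime (gcdn w1 w2) (h1 * t2 + (gcdn w1 w2).-1 * h2 * t1)%N.

Lemma natr_modF p k w (a : 'F_p) : (w%:R * a = 0)%R -> ((k %% w)%:R * a = k%:R * a)%R.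
Proof.
by move=> wa; rewrite {2}(divn_eq k w) natrD natrM mulrDl -mulrA wa mulr0 add0r.
Qed.

Lemma closed_perm (T : finType) (s : {perm T}) (A : {set T}) :
  (forall v, v \in A -> s v \in A) -> forall v, (s v \in A) = (v \in A).
Proof.
move=> h v; have eA : s @: A = A.
  apply/eqP; rewrite eqEcard card_imset ?leqnn ?andbT; last exact: perm_inj.
  by apply/subsetP=> _ /imsetP[x Ax ->]; apply: h.
by rewrite -{1}eA mem_imset //; apply: perm_inj.
Qed.

Lemma card_porbit_comm (T : finType) (s u : {perm T}) v : s * u = u * s ->
  #|porbit s (u v)| = #|porbit s v|.
Proof.
move=> su; have /= := @deform_card_porbit T s 1 u _ v.
by rewrite invg1 mulg1; apply=> x; rewrite perm1 -!permM su.
Qed.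

Lemma card_porbit_comm_iter (T : finType) (s u : {perm T}) v x y : s * u = u * s ->
  #|porbit s (iter y u (iter x s v))| = #|porbit s v|.
Proof.
move=> su; elim: y => [|y IH] /=; first by rewrite -permX porbit_perm.
by rewrite card_porbit_comm.
Qed.

(** * Potentials on one torus and on a pair of tori *)

Section Potentials.
Variables (p w h tau : nat) (a b : 'F_p).
Hypotheses (wa : (w%:R * a = 0)%R) (hb : (h%:R * b = tau%:R * a)%R).

(** The linear function with slopes [a], [b]. [wa] makes it close up around a row, and [hb] makes it
    match across the twisted gluing of the last row to the first. *)
Definition torF (z : 'I_w * 'I_h) : 'F_p := ((z.1 : nat)%:R * a + (z.2 : nat)%:R * b)%R.

Lemma torF_S z : torF (torS z) = (torF z + a)%R.
Proof. by rewrite /torF /torS /= natr_modF // -(natr1 z.1) mulrDl mul1r addrAC. Qed.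

Lemma torF_U z : torF (torU tau z) = (torF z + b)%R.
Proof.
rewrite /torF /torU /=; case: eqVneq => [e|ne].
  have hb' : (z.2.+1%:R * b = tau%:R * a)%R by rewrite e hb.
  rewrite e modnn mul0r addr0 iter_ordS_val natr_modF // natrD mulrDl -hb' -(natr1 z.2).
  by rewrite mulrDl mul1r addrA.
rewrite modn_small; last by rewrite ltn_neqAle ne ltn_ord.
by rewrite -(natr1 z.2) mulrDl mul1r addrA.
Qed.
End Potentials.

Section Model.
Variables (n w1 h1 w2 h2 : nat).
Hypotheses (w1_0 : 0 < w1) (w12 : w1 < w2) (h1_0 : 0 < h1) (h2_0 : 0 < h2).
Let w2_0 : 0 < w2 := ltn_trans w1_0 w12.
Implicit Types (s u : 'S_n).
Let Z : finType := (('I_w1 * 'I_h1) + ('I_w2 * 'I_h2))%type.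

Definition o1 : 'I_w1 * 'I_h1 := (Ordinal w1_0, Ordinal h1_0).
Definition o2 : 'I_w2 * 'I_h2 := (Ordinal w2_0, Ordinal h2_0).

Section Rigidity.
Variables (s u : 'S_n) (t1 t2 : nat) (phi1 : 'I_w1 * 'I_h1 -> 'I_n) (phi2 : 'I_w2 * 'I_h2 -> 'I_n).
Hypotheses (ch1 : chart s u t1 phi1) (ch2 : chart s u t2 phi2).
Hypothesis disj : forall z z', phi1 z != phi2 z'.
Hypothesis cover : forall v, (exists z, v = phi1 z) \/ (exists z, v = phi2 z).
Let b1 := phi1 o1.
Let b2 := phi2 o2.

Lemma chart_comm : s * u = u * s.
Proof.
have [_ s1 u1] := ch1; have [_ s2 u2] := ch2.
apply/permP=> v; rewrite !permM.
by case: (cover v) => -[z ->]; rewrite !(s1, u1, s2, u2) torSU.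
Qed.

Lemma chart_w1 : #|porbit s b1| = w1. Proof. exact: (chart_width ch1 w1_0 h1_0). Qed.
Lemma chart_w2 : #|porbit s b2| = w2. Proof. exact: (chart_width ch2 w2_0 h2_0). Qed.

Lemma chart_ltw : #|porbit s b1| < #|porbit s b2|.
Proof. by rewrite chart_w1 chart_w2. Qed.

Lemma rho_potential p (f : 'I_n -> 'F_p) a : (forall x, f (s x) = f x + a)%R ->
  f b1 = f b2 -> forall v, f (rho s b1 b2 v) = f v.
Proof.
move=> fs fb v; have lt := chart_ltw; have nb := rho_notin lt.
have fi k x : f (iter k s x) = (f x + k%:R * a)%R.
  elim: k => [|k IH] /=; first by rewrite mul0r addr0.
  by rewrite fs IH -(natr1 k) mulrDl mul1r addrA.
have [/porbit_iterP[k kw ->]|n1] := boolP (v \in porbit s b1).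
  by rewrite rhoL // !fi fb.
have [/porbit_iterP[k kw ->]|n2] := boolP (v \in porbit s b2); last by rewrite rho_out.
have [k1|k1] := ltnP k #|porbit s b1|; first by rewrite rhoR // !fi fb.
by rewrite rhoD ?k1.
Qed.

(** The slopes satisfy w_i a = 0 and h_i b = t_i a. If a is nonzero, p divides both widths and the
    determinant h1 t2 - h2 t1; if a = 0 and b is nonzero, p divides both heights. With zero slopes f
    is constant on each torus, and the commutator links the tori by sending [b1] to [b2]. *)
Lemma goodtwist_rigid : goodtwist w1 w2 h1 h2 t1 t2 -> rigid s (u * rho s b1 b2).
Proof.
move=> /andP[cph cpg] p f a b pr fs ft.
have lt := chart_ltw; have nb := rho_notin lt; have su := chart_comm.
have fc := potential_fcomm fs ft; rewrite (fcomm_rho su lt) in fc.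
have [_ c1 c2 ce _] := cycle3_c3 (uniq_rho nb lt).
have fb : f b1 = f b2 by rewrite -(fc b1) ce.
have frho := rho_potential fs fb.
have fu v : f (u v) = (f v + b)%R by rewrite -frho -ft permM.
have fis k x : f (iter k s x) = (f x + k%:R * a)%R.
  elim: k => [|k IH] /=; first by rewrite mul0r addr0.
  by rewrite fs IH -(natr1 k) mulrDl mul1r addrA.
have fiu k x : f (iter k u x) = (f x + k%:R * b)%R.
  elim: k => [|k IH] /=; first by rewrite mul0r addr0.
  by rewrite fu IH -(natr1 k) mulrDl mul1r addrA.
have canc k x : f (iter k s x) = f x -> (k%:R * a = 0)%R.
  by rewrite fis -{2}[f x]addr0 => /addrI.
have wa1 : (w1%:R * a = 0)%R.
  by apply: (canc _ b1); have := iter_porbit s b1; rewrite chart_w1 => ->.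
have wa2 : (w2%:R * a = 0)%R.
  by apply: (canc _ b2); have := iter_porbit s b2; rewrite chart_w2 => ->.
have hb1 : (h1%:R * b = t1%:R * a)%R.
  by have := congr1 f (chart_height_iter ch1 w1_0 h1_0); rewrite fiu fis => /addrI.
have hb2 : (h2%:R * b = t2%:R * a)%R.
  by have := congr1 f (chart_height_iter ch2 w2_0 h2_0); rewrite fiu fis => /addrI.
have dv k (d : 'F_p) : d != 0%R -> (k%:R * d = 0)%R -> p %| k.
  by move=> nz /eqP; rewrite mulf_eq0 (negPf nz) orbF Fp_nat_eq0.
have p1 k : p %| k -> k != 1%N.
  by apply: contraTneq => ->; rewrite dvdn1; apply: contraTneq pr => ->.
have a0 : a = 0%R.
  apply/eqP; apply: contraT => nza.
  have pg : p %| gcdn w1 w2 by rewrite dvdn_gcd !(dv _ _ nza).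
  have g0 : 0 < gcdn w1 w2 by rewrite gcdn_gt0 w1_0.
  have pD : p %| (h1 * t2 + (gcdn w1 w2).-1 * h2 * t1)%N.
    apply: (dv _ _ nza); rewrite natrD !natrM.
    have -> : ((gcdn w1 w2).-1%:R = -1 :> 'F_p)%R.
      have := natr1 (gcdn w1 w2).-1 : (_ = _ :> 'F_p)%R; rewrite prednK //.
      have /eqP-> : ((gcdn w1 w2)%:R == 0 :> 'F_p)%R by rewrite Fp_nat_eq0.
      by move/eqP; rewrite addr_eq0 => /eqP.
    rewrite mulN1r mulNr mulrBl -!mulrA -hb1 -hb2 mulrCA subrr //.
  have := p1 (gcdn (gcdn w1 w2) (h1 * t2 + (gcdn w1 w2).-1 * h2 * t1)%N).
  by rewrite dvdn_gcd pg pD (eqP cpg) => /(_ isT).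
have b0 : b = 0%R.
  apply/eqP; apply: contraT => nzb.
  have := p1 (gcdn h1 h2); rewrite dvdn_gcd !(dv _ _ nzb) ?hb1 ?hb2 ?a0 ?mulr0 //.
  by rewrite (eqP cph) => /(_ isT).
have f0 v : f v = f b1.
  case: (cover v) => -[z ->].
    by rewrite (chartE ch1 w1_0 h1_0) fiu fis a0 b0 !mulr0 !addr0.
  by rewrite (chartE ch2 w2_0 h2_0) fiu fis a0 b0 !mulr0 !addr0 fb.
by move=> x y; rewrite !f0.
Qed.

Let glue (z : Z) := match z with inl x => phi1 x | inr y => phi2 y end.

Lemma glue_inj : injective glue.
Proof.
have [i1 _ _] := ch1; have [i2 _ _] := ch2.
move=> [x|x] [y|y] /= e; rewrite ?(i1 _ _ e) ?(i2 _ _ e) //.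
  by case/eqP: (disj x y).
by case/eqP: (disj y x).
Qed.

(** A solution of the four equations yields a linear function on each torus. Both vanish at their
    base points and have the same slope along [s], so [rho] preserves the glued function, which is a
    potential. *)
Lemma rigid_no_solution p (a b : 'F_p) : prime p -> rigid s (u * rho s b1 b2) ->
  (w1%:R * a = 0)%R -> (w2%:R * a = 0)%R ->
  (h1%:R * b = t1%:R * a)%R -> (h2%:R * b = t2%:R * a)%R -> a = 0%R /\ b = 0%R.
Proof.
move=> pr rig wa1 wa2 hb1 hb2.
have psV v : {z | glue z == v}.
  apply: sigW; case: (cover v) => -[z ->]; [by exists (inl z) | by exists (inr z)].
pose g v := sval (psV v).
have gK v : glue (g v) = v by apply/eqP/(svalP (psV v)).
have Kg z : g (glue z) = z by apply: glue_inj; rewrite gK.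
pose f v := match g v with inl z => torF a b z | inr z => torF a b z end.
have f1 z : f (phi1 z) = torF a b z by rewrite /f -[phi1 z]/(glue (inl z)) Kg.
have f2 z : f (phi2 z) = torF a b z by rewrite /f -[phi2 z]/(glue (inr z)) Kg.
have [_ s1 u1] := ch1; have [_ s2 u2] := ch2.
have fs v : f (s v) = (f v + a)%R.
  by case: (cover v) => -[z ->]; rewrite ?s1 ?s2 ?f1 ?f2 torF_S.
have fu v : f (u v) = (f v + b)%R.
  by case: (cover v) => -[z ->]; rewrite ?u1 ?u2 ?f1 ?f2 torF_U.
have fb : f b1 = f b2 by rewrite f1 f2.
have ft v : f ((u * rho s b1 b2) v) = (f v + b)%R.
  by rewrite permM (rho_potential fs fb) fu.
have cst := rig p f a b pr fs ft.
split.
  by have := cst (s b1) b1; rewrite fs -{2}[f b1]addr0 => /addrI.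
by have := cst (u b1) b1; rewrite fu -{2}[f b1]addr0 => /addrI.
Qed.

Lemma rigid_goodtwist : rigid s (u * rho s b1 b2) -> goodtwist w1 w2 h1 h2 t1 t2.
Proof.
move=> rig.
have P1 m : 0 < m -> m != 1%N -> exists2 p, prime p & p %| m.
  by move=> m0 m1; exists (pdiv m); rewrite ?pdiv_dvd ?pdiv_prime //; lia.
have cph : coprime h1 h2.
  apply: contraT => nc; have [|p pr] := P1 _ _ nc; first by rewrite gcdn_gt0 h1_0.
  rewrite dvdn_gcd -!Fp_nat_eq0 // => /andP[/eqP p1 /eqP p2].
  have E1 : (h1%:R * 1 = t1%:R * 0 :> 'F_p)%R by rewrite p1 mul0r mulr0.
  have E2 : (h2%:R * 1 = t2%:R * 0 :> 'F_p)%R by rewrite p2 mul0r mulr0.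
  have [_ /eqP] := rigid_no_solution pr rig (mulr0 _) (mulr0 _) E1 E2.
  by rewrite oner_eq0.
rewrite /goodtwist cph /=; set g := gcdn w1 w2; apply: contraT => nc.
have g0 : 0 < g by rewrite gcdn_gt0 w1_0.
have [|p pr] := P1 _ _ nc; first by rewrite gcdn_gt0 g0.
rewrite dvdn_gcd => /andP[pg pD].
have gm : (g.-1%:R = -1 :> 'F_p)%R.
  have := natr1 g.-1 : (_ = _ :> 'F_p)%R; rewrite prednK //.
  have /eqP-> : (g%:R == 0 :> 'F_p)%R by rewrite Fp_nat_eq0.
  by move/eqP; rewrite addr_eq0 => /eqP.
have D0 : (h1%:R * t2%:R = h2%:R * t1%:R :> 'F_p)%R.
  move: pD; rewrite -Fp_nat_eq0 // natrD !natrM gm mulN1r mulNr subr_eq0 => /eqP //.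
have [pw1 pw2] : p %| w1 /\ p %| w2.
  by move: pg; rewrite dvdn_gcd => /andP[].
have /eqP W1 : (w1%:R == 0 :> 'F_p)%R by rewrite Fp_nat_eq0.
have /eqP W2 : (w2%:R == 0 :> 'F_p)%R by rewrite Fp_nat_eq0.
(* With a = 1 it is enough to solve for b. One height is invertible modulo p because the heights are
   coprime, and the vanishing determinant makes the quotient solve the other equation too. *)
have fin b : (h1%:R * b = t1%:R :> 'F_p)%R -> (h2%:R * b = t2%:R :> 'F_p)%R -> False.
  rewrite -(mulr1 t1%:R)%R -(mulr1 t2%:R)%R => e1 e2.
  have [/eqP] := rigid_no_solution pr rig (etrans (mulr1 _) W1) (etrans (mulr1 _) W2) e1 e2.
  by rewrite oner_eq0.
have [e1|n1] := eqVneq (h1%:R : 'F_p)%R 0%R.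
  have n2 : (h2%:R != 0 :> 'F_p)%R.
    apply/eqP=> e2; have : p %| gcdn h1 h2 by rewrite dvdn_gcd -!Fp_nat_eq0 // e1 e2 eqxx.
    by rewrite (eqP cph) dvdn1 => /eqP e; rewrite e in pr.
  case: (fin (t2%:R / h2%:R)%R); last by rewrite mulrC divfK.
  by apply: (mulfI n2); rewrite -D0 e1 !mul0r mulr0.
case: (fin (t1%:R / h1%:R)%R); first by rewrite mulrC divfK.
by apply: (mulfI n1); rewrite D0 mulrCA; congr (_ * _)%R; rewrite mulrC divfK.
Qed.
End Rigidity.
End Model.

Lemma twist_ltw (T : finType) (s u : {perm T}) b w :
  #|porbit s b| = w -> twist s u b < w.
Proof. by move=> <-; apply: twist_lt. Qed.

(** * Counting two-cylinder pairs with given widths and heights *)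

Section Count.
Variable n : nat.

Definition torpt (s u : 'S_n) (b : 'I_n) w h (z : 'I_w * 'I_h) := iter z.2 u (iter z.1 s b).

(** The tori are disjoint because their points lie on [s]-cycles of different lengths. Their union
    is closed under [s], [u] and [rho], so its indicator is a potential with zero increments, and
    rigidity makes it everything. *)
Lemma two_cyl_charts (s u : 'S_n) (b1 b2 : 'I_n) w1 h1 w2 h2 : ((s, u), (b1, b2)) \in two_cyl n ->
    #|porbit s b1| = w1 -> height s u b1 = h1 -> #|porbit s b2| = w2 -> height s u b2 = h2 ->
  [/\ chart s u (twist s u b1) (@torpt s u b1 w1 h1),
      chart s u (twist s u b2) (@torpt s u b2 w2 h2),
      forall z z', @torpt s u b1 w1 h1 z != @torpt s u b2 w2 h2 z'
    & forall v, (exists z, v = @torpt s u b1 w1 h1 z) \/ (exists z, v = @torpt s u b2 w2 h2 z)].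
Proof.
rewrite inE /= => /and3P[/eqP su lt /cAP[_ rig]] <- <- <- <-.
have ch1 := chart_exists b1 su; have ch2 := chart_exists b2 su.
split=> //.
  move=> z z'; apply: contraTneq lt => e; rewrite -leqNgt.
  have E1 : #|porbit s (torpt s u b1 z)| = #|porbit s b1| := card_porbit_comm_iter b1 z.1 z.2 su.
  have E2 : #|porbit s (torpt s u b2 z')| = #|porbit s b2| := card_porbit_comm_iter b2 z'.1 z'.2 su.
  by apply: eq_leq; rewrite -[LHS]E2 -[RHS]E1 e.
pose A := [set v | [exists z, v == @torpt s u b1 #|porbit s b1| (height s u b1) z] ||
                   [exists z, v == @torpt s u b2 #|porbit s b2| (height s u b2) z]].
have inA v : v \in A -> (exists z, v = @torpt s u b1 #|porbit s b1| (height s u b1) z)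
    \/ (exists z, v = @torpt s u b2 #|porbit s b2| (height s u b2) z).
  by rewrite inE => /orP[] /existsP[z /eqP->]; [left | right]; exists z.
have A1 z : @torpt s u b1 #|porbit s b1| (height s u b1) z \in A.
  by rewrite inE; apply/orP; left; apply/existsP; exists z.
have A2 z : @torpt s u b2 #|porbit s b2| (height s u b2) z \in A.
  by rewrite inE; apply/orP; right; apply/existsP; exists z.
have [_ s1 u1] := ch1; have [_ s2 u2] := ch2.
have As : forall v, (s v \in A) = (v \in A).
  by apply: closed_perm => v /inA[] [z ->]; rewrite /torpt ?s1 ?s2 ?A1 ?A2.
have Au : forall v, (u v \in A) = (v \in A).
  by apply: closed_perm => v /inA[] [z ->]; rewrite /torpt ?u1 ?u2 ?A1 ?A2.
have Ab1 : b1 \in A.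
  by apply: (A1 (Ordinal (porbit_gt0 s b1), Ordinal (height_gt0 s u b1))).
have Ab2 : b2 \in A.
  by apply: (A2 (Ordinal (porbit_gt0 s b2), Ordinal (height_gt0 s u b2))).
have Ai k v : (iter k s v \in A) = (v \in A) by elim: k => //= k IH; rewrite As.
have nb := rho_notin lt.
have Ar v : (rho s b1 b2 v \in A) = (v \in A).
  have [/porbit_iterP[k kw ->]|n1] := boolP (v \in porbit s b1).
    by rewrite rhoL // !Ai Ab1 Ab2.
  have [/porbit_iterP[k kw ->]|n2] := boolP (v \in porbit s b2); last by rewrite rho_out.
  have [k1|k1] := ltnP k #|porbit s b1|; first by rewrite rhoR // !Ai Ab1 Ab2.
  by rewrite rhoD ?k1.
pose f v : 'F_2 := (if v \in A then 1 else 0)%R.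
have fs v : f (s v) = (f v + 0)%R by rewrite /f As addr0.
have ft v : f ((u * rho s b1 b2) v) = (f v + 0)%R by rewrite /f permM Ar Au addr0.
move=> v; apply: inA; have := rig 2 f 0%R 0%R isT fs ft v b1.
by rewrite /f Ab1; case: (v \in A).
Qed.

Section Fiber.
Variables (w1 h1 w2 h2 : nat).
Hypotheses (w1_0 : 0 < w1) (w12 : w1 < w2) (h1_0 : 0 < h1) (h2_0 : 0 < h2).
Let w2_0 : 0 < w2 := ltn_trans w1_0 w12.
Hypothesis sumn : (w1 * h1 + w2 * h2 = n)%N.
Let Z : finType := (('I_w1 * 'I_h1) + ('I_w2 * 'I_h2))%type.

Definition cyl_key (q : ('S_n * 'S_n) * ('I_n * 'I_n)) :=
  (#|porbit q.1.1 q.2.1|, #|porbit q.1.1 q.2.2|,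
   height q.1.1 q.1.2 q.2.1, height q.1.1 q.1.2 q.2.2).

Definition fiber := [set q in two_cyl n | cyl_key q == (w1, w2, h1, h2)].

Definition coordZ (q : ('S_n * 'S_n) * ('I_n * 'I_n)) : {ffun Z -> 'I_n} :=
  [ffun z : Z => match z with
             | inl x => torpt q.1.1 q.1.2 q.2.1 x
             | inr y => torpt q.1.1 q.1.2 q.2.2 y end].

(** [insubd] only retypes the twists: on the fibre each is smaller than its width, so the default is
    never reached. *)
Definition fiber_data q : ('I_w1 * 'I_w2) * {ffun Z -> 'I_n} :=
  ((insubd (Ordinal w1_0) (twist q.1.1 q.1.2 q.2.1),
    insubd (Ordinal w2_0) (twist q.1.1 q.1.2 q.2.2)), coordZ q).

Lemma cardZ : #|Z| = n.
Proof. by rewrite card_sum !card_prod !card_ord. Qed.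

Lemma fiberP q : q \in fiber ->
  [/\ [/\ q \in two_cyl n, #|porbit q.1.1 q.2.1| = w1 & height q.1.1 q.1.2 q.2.1 = h1],
      #|porbit q.1.1 q.2.2| = w2 & height q.1.1 q.1.2 q.2.2 = h2].
Proof. by rewrite inE => /andP[-> /eqP[]]. Qed.

Lemma fiber_data_inj : {in fiber &, injective fiber_data}.
Proof.
move=> [[s u] [b1 b2]] [[s' u'] [b1' b2']] /fiberP /= [[hC e1 e2] e3 e4].
case/fiberP=> /= [[hC' e1' e2'] e3' e4'] E.
have [[i1 s1 u1] [i2 s2 u2] _ cov] := two_cyl_charts hC e1 e2 e3 e4.
have [[_ s1' u1'] [_ s2' u2'] _ _] := two_cyl_charts hC' e1' e2' e3' e4'.
have Et1 := congr1 (fun d => val d.1.1) E; have Et2 := congr1 (fun d => val d.1.2) E.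
rewrite /= !val_insubd !twist_ltw // in Et1 Et2.
have Ez (z : Z) : coordZ (s, u, (b1, b2)) z = coordZ (s', u', (b1', b2')) z.
  exact: (congr1 (fun d : _ * {ffun Z -> 'I_n} => d.2 z) E).
have E1 (z : 'I_w1 * 'I_h1) : torpt s u b1 z = torpt s' u' b1' z.
  by have := Ez (inl z); rewrite !ffunE.
have E2 (z : 'I_w2 * 'I_h2) : torpt s u b2 z = torpt s' u' b2' z.
  by have := Ez (inr z); rewrite !ffunE.
have es : s = s'.
  apply/permP=> v; case: (cov v) => -[z ->].
    by rewrite s1 !E1 s1'.
  by rewrite s2 !E2 s2'.
have eu : u = u'.
  apply/permP=> v; case: (cov v) => -[z ->].
    by rewrite u1 !E1 u1' Et1.
  by rewrite u2 !E2 u2' Et2.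
have eb1 : b1 = b1' := E1 (Ordinal w1_0, Ordinal h1_0).
have eb2 : b2 = b2' := E2 (Ordinal w2_0, Ordinal h2_0).
by rewrite es eu eb1 eb2.
Qed.

Lemma model_exists (t1 : 'I_w1) (t2 : 'I_w2) (phi : Z -> 'I_n) : injective phi ->
  exists s u : 'S_n, chart s u t1 (fun x => phi (inl x)) /\ chart s u t2 (fun x => phi (inr x)).
Proof.
move=> inj.
have [g gK Kg] : bijective phi by apply: inj_card_bij => //; rewrite cardZ card_ord.
pose S (z : Z) : Z := match z with inl x => inl (torS x) | inr y => inr (torS y) end.
pose U (z : Z) : Z := match z with inl x => inl (torU t1 x) | inr y => inr (torU t2 y) end.
have inlI (A B : Type) : injective (@inl A B) by move=> x y [].
have inrI (A B : Type) : injective (@inr A B) by move=> x y [].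
have Si : injective (fun v => phi (S (g v))).
  move=> v v' /inj; rewrite -{2}(Kg v) -{2}(Kg v').
  by case: (g v) (g v') => [x|x] [y|y] //= => [/(inlI _ _ _ _)|/(inrI _ _ _ _)] /torS_inj->.
have Ui : injective (fun v => phi (U (g v))).
  move=> v v' /inj; rewrite -{2}(Kg v) -{2}(Kg v').
  by case: (g v) (g v') => [x|x] [y|y] //= => [/(inlI _ _ _ _)|/(inrI _ _ _ _)] /torU_inj->.
exists (perm Si), (perm Ui); split; split.
- by move=> x y /inj/(inlI _ _ _ _).
- by move=> z; rewrite permE gK.
- by move=> z; rewrite permE gK.
- by move=> x y /inj/(inrI _ _ _ _).
- by move=> z; rewrite permE gK.
by move=> z; rewrite permE gK.
Qed.

(** An element of the fibre is the standard pair of tori with admissible twists, carried over by a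
    labelling of its n cells. The two base points determine the labelling, so there is no
    automorphism to divide by. *)
Lemma card_fiber :
  #|fiber| = (n`! * #|[set t : 'I_w1 * 'I_w2 | goodtwist w1 w2 h1 h2 t.1 t.2]|)%N.
Proof.
have -> : n`! = #|[set f : {ffun Z -> 'I_n} | injectiveb f]|.
  by rewrite card_inj_ffuns card_ord cardZ ffactnn.
rewrite mulnC -cardsX -(card_in_imset fiber_data_inj); apply: eq_card => -[[t1 t2] phi].
apply/imsetP/idP.
  case=> -[[s u] [b1 b2]] Fq E; have /= [[hC e1 e2] e3 e4] := fiberP Fq.
  have [ch1 ch2 dj cov] := two_cyl_charts hC e1 e2 e3 e4.
  move: E => /= [-> -> ->]; rewrite !inE /= !val_insubd !twist_ltw //.
  apply/andP; split.
    apply: (@rigid_goodtwist n w1 h1 w2 h2 w1_0 w12 h1_0 h2_0 s u _ _ _ _ ch1 ch2 dj cov).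
    by move: hC; rewrite inE => /and3P[_ _ /cAP[]].
  apply/injectiveP=> x y; rewrite !ffunE; exact: (glue_inj ch1 ch2 dj).
rewrite !inE /= => /andP[gt /injectiveP inj].
have [s [u [ch1 ch2]]] := model_exists t1 t2 inj.
have [g gK Kg] : bijective phi by apply: inj_card_bij => //; rewrite cardZ card_ord.
have dj z z' : phi (inl z) != phi (inr z') by apply/eqP=> /inj.
have cov v : (exists z, v = phi (inl z)) \/ (exists z, v = phi (inr z)).
  by rewrite -[v]Kg; case: (g v) => z; [left | right]; exists z.
pose b1 := phi (inl (Ordinal w1_0, Ordinal h1_0)).
pose b2 := phi (inr (Ordinal w2_0, Ordinal h2_0)).
have c1 : #|porbit s b1| = w1 := chart_width ch1 w1_0 h1_0.
have c2 : #|porbit s b2| = w2 := chart_width ch2 w2_0 h2_0.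
have su := chart_comm ch1 ch2 cov.
have lt : #|porbit s b1| < #|porbit s b2| by rewrite c1 c2.
exists ((s, u), (b1, b2)).
  rewrite inE /cyl_key /= c1 c2 (chart_height ch1) (chart_height ch2) eqxx andbT.
  rewrite inE /= su eqxx lt /=; apply/cAP; split; last first.
    exact: (@goodtwist_rigid n w1 h1 w2 h2 w1_0 w12 h1_0 h2_0 s u _ _ _ _ ch1 ch2 cov gt).
  rewrite (fcomm_rho su lt); apply/is_3cycleP; do 3!eexists.
  apply: cycle3_c3; apply: uniq_rho => //; exact: rho_notin.
rewrite /fiber_data /=; congr (_, _, _).
- by apply: val_inj; rewrite /= val_insubd (chart_twist ch1) // ltn_ord.
- by apply: val_inj; rewrite /= val_insubd (chart_twist ch2) // ltn_ord.
apply/ffunP=> -[z|z]; rewrite ffunE /torpt /=.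
  exact: (chartE ch1 w1_0 h1_0).
exact: (chartE ch2 w2_0 h2_0).
Qed.
End Fiber.

Definition admissible (k : nat * nat * nat * nat) :=
  let: (w1, w2, h1, h2) := k in
  [&& 0 < w1, w1 < w2, 0 < h1, 0 < h2 & w1 * h1 + w2 * h2 == n]%N.

Lemma cyl_key_admissible q : q \in two_cyl n -> admissible (cyl_key q).
Proof.
case: q => -[s u] [b1 b2] hC; rewrite /cyl_key /=.
have [ch1 ch2 dj cov] := two_cyl_charts hC erefl erefl erefl erefl.
have lt : #|porbit s b1| < #|porbit s b2| by move: hC; rewrite inE => /and3P[].
rewrite porbit_gt0 lt !height_gt0 /=; apply/eqP.
have inj := glue_inj ch1 ch2 dj.
have := card_codom inj; rewrite card_sum !card_prod !card_ord => <-.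
rewrite -[RHS]card_ord; apply: eq_card => v; rewrite [RHS]inE; apply/codomP.
by case: (cov v) => -[z ->]; [exists (inl z) | exists (inr z)].
Qed.

Lemma card_two_cyl : #|two_cyl n| = (n`! *
  \sum_(k : 'I_n.+1 * 'I_n.+1 * 'I_n.+1 * 'I_n.+1 |
     admissible (k.1.1.1 : nat, k.1.1.2 : nat, k.1.2 : nat, k.2 : nat))
   #|[set t : 'I_k.1.1.1 * 'I_k.1.1.2 | goodtwist k.1.1.1 k.1.1.2 k.1.2 k.2 t.1 t.2]|)%N.
Proof.
(* All four parameters are at most n because they are positive and w1 h1 + w2 h2 = n, so [inord]
   loses nothing. *)
pose K q : 'I_n.+1 * 'I_n.+1 * 'I_n.+1 * 'I_n.+1 :=
  let: (w1, w2, h1, h2) := cyl_key q in (inord w1, inord w2, inord h1, inord h2).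
pose V (k : 'I_n.+1 * 'I_n.+1 * 'I_n.+1 * 'I_n.+1) :=
  (k.1.1.1 : nat, k.1.1.2 : nat, k.1.2 : nat, k.2 : nat).
have VK q : q \in two_cyl n -> V (K q) = cyl_key q.
  move/cyl_key_admissible; rewrite /V /K; case: (cyl_key q) => [[[a b] c] d] /=.
  case/and5P=> a0 ab c0 d0 /eqP e.
  rewrite !inordK //; nia.
rewrite -sum1_card (partition_big K (fun k => admissible (V k))) /=; last first.
  by move=> q hq; change (admissible (V (K q))); rewrite VK // cyl_key_admissible.
rewrite big_distrr /=; apply: eq_bigr => -[[[w1 w2] h1] h2] /= ad.
case/and5P: (ad) => a0 ab c0 d0 /eqP e.
rewrite -(card_fiber a0 ab c0 d0 e) -sum1_card; apply: eq_bigl => q; rewrite [in RHS]inE.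
case hC: (q \in two_cyl n) => //=.
apply/eqP/eqP => [eK|ek].
  by rewrite -VK // eK.
by rewrite /K ek !inord_val.
Qed.
End Count.

Local Close Scope group_scope.

(** * Equidistribution and totients *)

Section Equidistribution.
Variables (X : finType) (g : nat) (L : X -> nat) (sh : X -> X).
Hypotheses (g0 : 0 < g) (sh_inj : injective sh).
Hypothesis Lsh : forall x, L (sh x) = (L x).+1 %[mod g].

Lemma equi_step m : #|[set x | L x == m.+1 %[mod g]]| = #|[set x | L x == m %[mod g]]|.
Proof.
have [ish shK ishK] := injF_bij sh_inj.
rewrite -(card_imset [set x | L x == m %[mod g]] sh_inj); apply: eq_card => x.
have xE y : (L (sh y) == m.+1 %[mod g]) = (L y == m %[mod g]).
  by rewrite Lsh -(addn1 (L _)) -(addn1 m) eqn_modDr.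
apply/idP/imsetP => [|[y]]; last by rewrite !inE => e ->; rewrite xE.
by rewrite inE -{1}[x]ishK xE => h; exists (ish x); rewrite ?inE ?ishK.
Qed.

Lemma equi_const m : #|[set x | L x == m %[mod g]]| = #|[set x | L x == 0 %[mod g]]|.
Proof. by elim: m => // m IH; rewrite equi_step. Qed.

Lemma equi_class m : #|[set x | L x == m %[mod g]]| * g = #|X|.
Proof.
transitivity (\sum_(i < g) #|[set x | L x == i %[mod g]]|).
  under eq_bigr => i _ do rewrite equi_const.
  by rewrite sum_nat_const card_ord equi_const mulnC.
rewrite -[RHS]sum1_card (partition_big (fun x => Ordinal (ltn_pmod (L x) g0)) predT) //=.
apply: eq_bigr => i _; rewrite -sum1_card; apply: eq_bigl => x.
by rewrite !inE /= -val_eqE /= [i %% g]modn_small.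
Qed.

(** The bijection [sh] carries each residue class of [L] onto the next, so all g classes have the
    same size, and [totient g] of them are coprime to g. *)
Lemma card_coprime_equi : #|[set x | coprime g (L x)]| * g = #|X| * totient g.
Proof.
rewrite -(equi_class 0) -mulnA [g * _]mulnC mulnA; congr (_ * g).
rewrite totient_count_coprime big_mkord mulnC big_distrl -sum1_card /=.
rewrite (partition_big (fun x => Ordinal (ltn_pmod (L x) g0)) predT) //=.
apply: eq_bigr => i _; rewrite -(equi_const i).
have [ci|nci] := boolP (coprime g i); last first.
  rewrite mul0n big1 // => x; rewrite inE -val_eqE /= => /andP[cx /eqP e].
  by move: nci; rewrite -e coprime_modr cx.
rewrite mul1n -sum1_card; apply: eq_bigl => x; rewrite !inE -val_eqE /= [i %% g]modn_small //.
apply: andb_idl => /eqP e; by rewrite -coprime_modr e.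
Qed.
End Equidistribution.

Lemma card_coprime_ord n g : 0 < n -> g %| n ->
  #|[set x : 'I_n | coprime g x]| * g = n * totient g.
Proof.
case: n => // m _ gm; have g0 : 0 < g by apply: dvdn_gt0 gm.
transitivity (#|'I_m.+1| * totient g); last by rewrite card_ord.
apply: (@card_coprime_equi 'I_m.+1 g (fun x => x) (@ordS _)) => //; first exact: ordS_inj.
by move=> x; rewrite /= modn_dvdm.
Qed.

(** A Bezout relation h1 y - h2 x = 1 gives a translation of the twists by (x, y) that raises the
    determinant by 1 modulo g. Reducing twists modulo the widths is harmless because g divides
    both. *)
Lemma card_goodtwist w1 w2 h1 h2 : 0 < w1 -> 0 < w2 -> 0 < h1 -> coprime h1 h2 ->
  #|[set t : 'I_w1 * 'I_w2 |
      coprime (gcdn w1 w2) (h1 * t.2 + (gcdn w1 w2).-1 * h2 * t.1)]| * gcdn w1 w2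
  = w1 * w2 * totient (gcdn w1 w2).
Proof.
case: w1 w2 => [|v1] // [|v2] // _ _ h1_0 cp.
set w1 := v1.+1; set w2 := v2.+1; set g := gcdn w1 w2.
have g0 : 0 < g by rewrite gcdn_gt0.
have gw1 : g %| w1 by apply: dvdn_gcdl.
have gw2 : g %| w2 by apply: dvdn_gcdr.
have -> : w1 * w2 = #|{: 'I_w1 * 'I_w2}| by rewrite card_prod !card_ord.
have [y [x exy]] : exists y x, h1 * y + g.-1 * h2 * x = 1 %[mod g].
  have /(coprimeP _ h1_0)[[y x] /= e] := cp; exists y, x.
  have -> : h1 * y + g.-1 * h2 * x = h2 * x * g + 1 by nia.
  by rewrite modnMDl.
have key a b c d : a = c %[mod g] -> b = d %[mod g] ->
    h1 * b + g.-1 * h2 * a = h1 * d + g.-1 * h2 * c %[mod g].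
  by move=> e1 e2; rewrite -modnDm -modnMmr e2 modnMmr -[_ * a %% _]modnMmr e1 modnMmr modnDm.
apply: (@card_coprime_equi _ g (fun t : 'I_w1 * 'I_w2 => h1 * t.2 + g.-1 * h2 * t.1)
   (fun t : 'I_v1.+1 * 'I_v2.+1 => (t.1 + inZp x, t.2 + inZp y)%R)) => //.
  move=> [a b] [c d] e; have /= /addIr e1 := congr1 fst e.
  by have /= /addIr e2 := congr1 snd e; rewrite e1 e2.
have md w (c z : nat) : g %| w -> (c + z %% w) %% w = c + z %[mod g].
  by move=> gw; rewrite modnDmr modn_dvdm.
move=> [a b] /=; rewrite (key _ _ _ _ (md _ a x gw1) (md _ b y gw2)).
by rewrite !mulnDr addnACA -modnDmr exy modnDmr addn1.
Qed.

Local Open Scope ring_scope.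

(** * Moments of [psi (gcdn n b)] and Jordan's totient *)

Definition psi (g : nat) : rat := (totient g)%:R / g%:R.

Lemma psi_prod g : (0 < g)%N -> psi g = \prod_(p <- primes g) (1 - (p%:R)^-1).
Proof.
move=> g0; have eg : (g = \prod_(p <- primes g) p ^ logn p g)%N.
  by rewrite {1}(prod_prime_decomp g0) prime_decompE big_map.
rewrite /psi totientE // [X in _ / X%:R]eg !natr_prod -prodf_div.
rewrite big_seq [RHS]big_seq; apply: eq_bigr => p.
rewrite mem_primes => /and3P[pr _ pg].
have l0 : (0 < logn p g)%N by rewrite logn_gt0 mem_primes pr g0.
have p0 : (p%:R : rat) != 0 by rewrite pnatr_eq0 -lt0n prime_gt0.
rewrite -{2}(prednK l0) natrM expnS !natrM natrX.
have -> : (p.-1%:R : rat) = p%:R - 1 by rewrite -subn1 natrB ?prime_gt0.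
have X0 : (p%:R : rat) ^+ (logn p g).-1 != 0 by rewrite expf_neq0.
by field; rewrite X0 p0.
Qed.

Lemma psi_gcd n b : (0 < n)%N ->
  psi (gcdn n b) = \prod_(p <- primes n | (p %| b)%N) (1 - (p%:R)^-1).
Proof.
move=> n0; rewrite psi_prod ?gcdn_gt0 ?n0 // -[RHS]big_filter; apply: perm_big.
apply: uniq_perm; rewrite ?primes_uniq ?filter_uniq ?primes_uniq // => p.
rewrite mem_filter !mem_primes gcdn_gt0 n0 /= dvdn_gcd.
by case: (prime p) => //=; rewrite ?andbF // andbC.
Qed.

(** For [ps = primes n] this is the k-th moment. The list is kept separate from n so that primes can
    be removed one by one: the recursion relates n to n/p, which p may still divide. *)
Definition psi_sum (k : nat) (ps : seq nat) (n : nat) : rat :=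
  \sum_(b < n.+1 | (0 < b)%N) b%:R ^+ k * \prod_(p <- ps | (p %| b)%N) (1 - (p%:R)^-1).

Lemma sum_multiples p m (F : nat -> rat) : (0 < p)%N ->
  \sum_(b < (p * m).+1 | (0 < b)%N && (p %| b)%N) F b = \sum_(c < m.+1 | (0 < c)%N) F (p * c)%N.
Proof.
move=> p0.
rewrite (reindex_onto (fun c : 'I_m.+1 => inord (p * c) : 'I_(p * m).+1)
                      (fun b : 'I_(p * m).+1 => inord (b %/ p) : 'I_m.+1)) /=.
  apply: eq_big => [c|c _].
    have lt : (p * c < (p * m).+1)%N by rewrite ltnS leq_mul2l -ltnS ltn_ord orbT.
    rewrite inordK // dvdn_mulr // muln_gt0 p0 andbT /=.
    by rewrite mulKn // inord_val eqxx andbT.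
  by rewrite inordK // ltnS leq_mul2l -ltnS ltn_ord orbT.
move=> b /andP[_ pb]; apply: val_inj; rewrite /= inordK.
  rewrite inordK; first by rewrite mulnC divnK.
  by rewrite ltnS -(leq_pmul2l p0) mulnC divnK // -ltnS.
rewrite inordK; last by rewrite ltnS -(leq_pmul2l p0) mulnC divnK // -ltnS.
by rewrite mulnC divnK.
Qed.

(* (1 - 1/p) [p | b] + [~ p | b] = 1 - [p | b] / p, and the multiples of p rescale. *)
Lemma psi_sum_rec k p ps m : prime p -> all prime ps -> p \notin ps ->
  psi_sum k (p :: ps) (p * m) = psi_sum k ps (p * m) - p%:R ^+ k / p%:R * psi_sum k ps m.
Proof.
move=> pr prs pps.
have E (b : nat) : \prod_(q <- p :: ps | (q %| b)%N) (1 - (q%:R)^-1) =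
   \prod_(q <- ps | (q %| b)%N) (1 - (q%:R)^-1)
    - (if (p %| b)%N then (p%:R)^-1 * \prod_(q <- ps | (q %| b)%N) (1 - (q%:R)^-1) else 0) :> rat.
  by rewrite big_cons; case: ifP => _; rewrite ?subr0 // mulrBl mul1r.
rewrite /psi_sum; under eq_bigr => b _ do rewrite E mulrBr.
rewrite sumrB; congr (_ - _).
transitivity (\sum_(b < (p * m).+1 | (0 < b)%N && (p %| b)%N)
   (b%:R ^+ k * ((p%:R)^-1 * \prod_(q <- ps | (q %| b)%N) (1 - (q%:R)^-1)) : rat)).
  by rewrite big_mkcondr; apply: eq_bigr => b _; case: ifP => _; rewrite ?mulr0.
rewrite (sum_multiples m (fun b => b%:R ^+ k *
  ((p%:R)^-1 * \prod_(q <- ps | (q %| b)%N) (1 - (q%:R)^-1))) (prime_gt0 pr)).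
rewrite big_distrr /=; apply: eq_bigr => c _.
have -> : \prod_(q <- ps | (q %| p * c)%N) (1 - (q%:R)^-1) =
          \prod_(q <- ps | (q %| c)%N) (1 - (q%:R)^-1) :> rat.
  rewrite big_seq_cond [RHS]big_seq_cond; apply: eq_bigl => q; apply: andb_id2l => qps.
  have prq := allP prs q qps; rewrite Euclid_dvdM // dvdn_prime2 //.
  by rewrite orb_idl // => /eqP e; rewrite -e qps in pps.
by rewrite natrM exprMn; ring.
Qed.

(** Under the recursion of [psi_sum k], a term n^j is multiplied by 1 - p^(k-1-j) for each prime. So
    the closed forms below are the power sum polynomials with n^j weighted by
    [euler_prod (j + 1 - k)]. *)
Definition euler_prod (k : nat) (ps : seq nat) : rat := \prod_(p <- ps) (1 - (p%:R ^+ k)^-1).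

Lemma psi_sum_nil k n : psi_sum k [::] n = \sum_(b < n.+1 | (0 < b)%N) b%:R ^+ k.
Proof. by apply: eq_bigr => b _; rewrite big_nil mulr1. Qed.

Lemma sum_pow_rec k n :
  \sum_(b < n.+2 | (0 < b)%N) (b%:R : rat) ^+ k =
  \sum_(b < n.+1 | (0 < b)%N) b%:R ^+ k + n.+1%:R ^+ k.
Proof. by rewrite big_mkcond big_ord_recr /= -big_mkcond. Qed.

Lemma sum_pow_0 k : \sum_(b < 1 | (0 < b)%N) (b%:R : rat) ^+ k = 0.
Proof. by rewrite big_mkcond big_ord_recr big_ord0 /= addr0. Qed.

Lemma psi_sum_ind (k : nat) (W : seq nat -> nat -> rat) :
  (forall n, W [::] n = \sum_(b < n.+1 | (0 < b)%N) b%:R ^+ k) ->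
  (forall p ps m, prime p -> W (p :: ps) (p * m)%N = W ps (p * m)%N - p%:R ^+ k / p%:R * W ps m) ->
  forall ps n, all prime ps -> uniq ps -> (forall p, p \in ps -> (p %| n)%N) ->
  psi_sum k ps n = W ps n.
Proof.
move=> W0 WS; elim=> [|p ps IH] n; first by rewrite psi_sum_nil W0.
move=> /= /andP[pr prs] /andP[pps ups] dv.
have /dvdnP[m en] : (p %| n)%N by apply: dv; rewrite mem_head.
rewrite mulnC in en; rewrite en in dv *; rewrite psi_sum_rec // WS //; congr (_ - _ * _).
  by apply: IH => // q qps; apply: dv; rewrite inE qps orbT.
apply: IH => // q qps; have := dv q; rewrite inE qps orbT => /(_ isT).
have prq := allP prs q qps; rewrite Euclid_dvdM // dvdn_prime2 // => /orP[/eqP e|//].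
by rewrite -e qps in pps.
Qed.

Lemma psi_sum0 ps n : all prime ps -> uniq ps -> (forall p, p \in ps -> (p %| n)%N) ->
  psi_sum 0 ps n = n%:R * euler_prod 2 ps.
Proof.
apply: (psi_sum_ind (W := fun ps n => n%:R * euler_prod 2 ps)) => [{}n|p {}ps m pr].
  rewrite /euler_prod big_nil mulr1; elim: n => [|n IH]; first by rewrite sum_pow_0.
  by rewrite sum_pow_rec -IH expr0 natr1.
have p0 : (p%:R : rat) != 0 by rewrite pnatr_eq0 -lt0n prime_gt0.
by rewrite /euler_prod big_cons natrM; field.
Qed.

Lemma psi_sum1 ps n : all prime ps -> uniq ps -> (forall p, p \in ps -> (p %| n)%N) ->
  psi_sum 1 ps n = n%:R ^+ 2 / 2 * euler_prod 2 ps + n%:R / 2 * euler_prod 1 ps.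
Proof.
apply: (psi_sum_ind (W := fun ps n => n%:R ^+ 2 / 2 * euler_prod 2 ps + n%:R / 2 * euler_prod 1 ps))
  => [{}n|p {}ps m pr].
  rewrite /euler_prod !big_nil; elim: n => [|n IH]; first by rewrite sum_pow_0; field.
  by rewrite sum_pow_rec -IH -natr1; field.
have p0 : (p%:R : rat) != 0 by rewrite pnatr_eq0 -lt0n prime_gt0.
by rewrite /euler_prod !big_cons natrM; field.
Qed.

Lemma psi_sum2 ps n : all prime ps -> uniq ps -> (forall p, p \in ps -> (p %| n)%N) ->
  psi_sum 2 ps n = n%:R ^+ 3 / 3 * euler_prod 2 ps + n%:R ^+ 2 / 2 * euler_prod 1 ps
                   + n%:R / 6 * euler_prod 0 ps.
Proof.
apply: (psi_sum_ind (W := fun ps n => n%:R ^+ 3 / 3 * euler_prod 2 ps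
  + n%:R ^+ 2 / 2 * euler_prod 1 ps + n%:R / 6 * euler_prod 0 ps)) => [{}n|p {}ps m pr].
  rewrite /euler_prod !big_nil; elim: n => [|n IH]; first by rewrite sum_pow_0; field.
  by rewrite sum_pow_rec -IH -natr1; field.
have p0 : (p%:R : rat) != 0 by rewrite pnatr_eq0 -lt0n prime_gt0.
by rewrite /euler_prod !big_cons natrM; field.
Qed.

Section Moments.
Variable n : nat.
Hypothesis n1 : (1 < n)%N.
Let n0 : (0 < n)%N := ltnW n1.

Definition moment k : rat := \sum_(b < n.+1 | (0 < b)%N) b%:R ^+ k * psi (gcdn n b).

Lemma momentE k : moment k = psi_sum k (primes n) n.
Proof. by apply: eq_bigr => b _; rewrite psi_gcd. Qed.

Lemma euler_prod2 : n%:R ^+ 2 * euler_prod 2 (primes n) = J2 n.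
Proof. by []. Qed.

Lemma euler_prod1 : n%:R * euler_prod 1 (primes n) = (totient n)%:R.
Proof.
have nz : (n%:R : rat) != 0 by rewrite pnatr_eq0 -lt0n.
have -> : euler_prod 1 (primes n) = psi n.
  by rewrite psi_prod //; apply: eq_bigr => p _; rewrite expr1.
by rewrite /psi mulrC divfK.
Qed.

(** Every factor is 1 - 1, and there is at least one since n > 1. This removes the linear term of
    the second moment. *)
Lemma euler_prod0 : euler_prod 0 (primes n) = 0.
Proof.
rewrite /euler_prod; case E: (primes n) => [|p ps]; last first.
  by rewrite big_cons expr0 invr1 subrr mul0r.
by move/eqP: E; rewrite primes_eq0; move: n1; case: (n) => [|[|m]].
Qed.

Lemma primes_ok :
  [/\ all prime (primes n), uniq (primes n) & forall p, p \in primes n -> (p %| n)%N].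
Proof.
split; [exact: all_prime_primes | exact: primes_uniq |].
by move=> p; rewrite mem_primes => /and3P[].
Qed.

Lemma moment0 : n%:R * moment 0 = J2 n.
Proof. by have [h1 h2 h3] := primes_ok; rewrite momentE psi_sum0 // -euler_prod2; ring. Qed.

Lemma moment1 : moment 1 = J2 n / 2 + (totient n)%:R / 2.
Proof.
by have [h1 h2 h3] := primes_ok; rewrite momentE psi_sum1 // -euler_prod2 -euler_prod1; field.
Qed.

Lemma moment2 : moment 2 = n%:R * J2 n / 3 + n%:R * (totient n)%:R / 2.
Proof.
have [h1 h2 h3] := primes_ok.
by rewrite momentE psi_sum2 // euler_prod0 -euler_prod2 -euler_prod1; field.
Qed.
End Moments.

Lemma sum_gcd_shift (n : nat) (f : nat -> rat) :
  \sum_(b < n.+1 | (0 < b)%N) f (gcdn n b) = \sum_(b < n) f (gcdn n b).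
Proof.
have e1 : \sum_(b < n.+1) f (gcdn n b) = f n + \sum_(b < n.+1 | (0 < b)%N) f (gcdn n b).
  by rewrite big_ord_recl /= gcdn0 [in RHS]big_mkcond [in RHS]big_ord_recl /= add0r.
have e2 : \sum_(b < n.+1) f (gcdn n b) = f n + \sum_(b < n) f (gcdn n b).
  by rewrite big_ord_recr /= gcdnn addrC.
by move: e1; rewrite e2 => /addrI.
Qed.

Section TripleCount.
Variable n : nat.
Hypothesis n1 : (1 < n)%N.
Let n0 : (0 < n)%N := ltnW n1.

Lemma card_coprimes : #|[set i : 'I_n | coprime n i]| = totient n.
Proof.
by have /eqP := card_coprime_ord n0 (dvdnn n); rewrite mulnC eqn_pmul2l // => /eqP.
Qed.

Let F := [set ji : 'I_n * 'I_n | gcdn n (gcdn ji.1 ji.2) == 1%N].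

(** For fixed i the condition is that j be coprime to gcd(n, i), a divisor of n, which leaves n
    psi(gcd(n, i)) values; the sum over i is n times the zeroth moment. *)
Lemma card_coprime_pairs : (#|F|%:R : rat) = J2 n.
Proof.
have -> : #|F| = (\sum_(i < n) #|[set j : 'I_n | coprime (gcdn n i) j]|)%N.
  rewrite -sum1_card (partition_big (fun ji => ji.2) predT) //=.
  apply: eq_bigr => i _; rewrite -sum1_card.
  rewrite (reindex_onto (fun j => (j, i)) (fun ji => ji.1)) /=; last first.
    by case=> j i' /= /andP[_ /eqP->].
  by apply: eq_bigl => j; rewrite !inE /= !eqxx !andbT /coprime gcdnAC gcdnA.
rewrite -(moment0 n1) /moment.
under [in RHS]eq_bigr => b _ do rewrite expr0 mul1r.
rewrite (sum_gcd_shift n psi) natr_sum mulr_sumr; apply: eq_bigr => i _.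
have g0 : ((gcdn n i)%:R : rat) != 0 by rewrite pnatr_eq0 -lt0n gcdn_gt0 n0.
have /(congr1 (fun k => k%:R : rat)) := card_coprime_ord n0 (dvdn_gcdl n i).
by rewrite !natrM /psi => e; apply: (mulIf g0); rewrite e; field.
Qed.

(** The pairs with gcd 1 split into 0 < j < i, its mirror image, and the three lines j = 0, i = 0
    and j = i, each with [totient n] points. The lines meet only in (0, 0), which is excluded as n >
    1. *)
Lemma card_tripleset (o : 'I_n) : nat_of_ord o = 0%N ->
  J2 n = 2 * (#|tripleset n|)%:R + 3 * (totient n)%:R.
Proof.
move=> o0; rewrite -card_coprime_pairs -!natrM -natrD; congr (_%:R).
have injr : injective (fun i : 'I_n => (o, i)) by move=> i i' [].
have injl : injective (fun i : 'I_n => (i, o)) by move=> i i' [].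
have injd : injective (fun i : 'I_n => (i, i)) by move=> i i' [].
have injs : injective (fun ji : 'I_n * 'I_n => (ji.2, ji.1)) by case=> ? ? [? ?] [-> ->].
pose C := [set i : 'I_n | coprime n i].
transitivity (#|tripleset n| + #|[set (ji.2, ji.1) | ji in tripleset n]| +
   (#|[set (o, i) | i in C]| + #|[set (i, o) | i in C]| + #|[set (i, i) | i in C]|))%N; last first.
  rewrite !card_imset // card_coprimes; lia.
rewrite -!sum1_card !(big_mkcond (fun i => i \in _)) -!big_split /=.
apply: eq_bigr => -[j i] _.
have mr : ((j, i) \in [set (o, i) | i in C]) = (j == 0%N :> nat) && coprime n i.
  apply/imsetP/andP => [[i']|[/eqP j0 ci]]; first by rewrite inE => c [-> ->]; rewrite o0.
  by exists i; rewrite ?inE //; congr (_, _); apply: val_inj; rewrite /= j0.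
have ml : ((j, i) \in [set (i, o) | i in C]) = (i == 0%N :> nat) && coprime n j.
  apply/imsetP/andP => [[i']|[/eqP j0 ci]]; first by rewrite inE => c [-> ->]; rewrite o0.
  by exists j; rewrite ?inE //; congr (_, _); apply: val_inj; rewrite /= j0.
have md : ((j, i) \in [set (i, i) | i in C]) = (j == i :> nat) && coprime n j.
  apply/imsetP/andP => [[i']|[/eqP j0 ci]]; first by rewrite inE => c [-> ->].
  by exists j; rewrite ?inE //; congr (_, _); apply: val_inj; rewrite /= j0.
have ms : ((j, i) \in [set (ji.2, ji.1) | ji in tripleset n]) = ((i, j) \in tripleset n).
  by rewrite -[(j, i)]/((fun ji : 'I_n * 'I_n => (ji.2, ji.1)) (i, j)) mem_imset.
rewrite {}mr {}ml {}md {}ms !inE /= [gcdn i j]gcdnC /coprime.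
have ng : (n == 1%N) = false by apply/eqP; lia.
have [j0|j0] := posnP j; have [i0|i0] := posnP i.
- by rewrite j0 i0 !gcdn0 ng.
- by rewrite j0 gcd0n (ltn_eqF i0) ltn0 /=; case: ifP.
- by rewrite i0 gcdn0 (gtn_eqF j0) ltn0 /=; case: ifP.
by case: (ltngtP j i) => [lt|lt|->] /=; rewrite ?gcdnn; case: ifP.
Qed.
End TripleCount.

Section DivisorSum.
Variable n : nat.
Hypothesis n0 : (0 < n)%N.

Lemma sum_gcd_class (a m : nat) (f : nat -> rat) : n = (a * m)%N ->
  \sum_(b < n.+1 | (0 < b)%N && (gcdn n b == a)) f (gcdn n b) = (totient m)%:R * f a.
Proof.
move=> en; have a0 : (0 < a)%N by move: n0; rewrite en muln_gt0 => /andP[].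
rewrite (eq_bigr (fun _ => f a)); last by move=> b /andP[_ /eqP <-].
transitivity (f a * \sum_(b < n.+1 | (0 < b)%N && (a %| b)%N) (gcdn n b == a)%:R).
  rewrite mulr_sumr [LHS]big_mkcond [RHS]big_mkcond; apply: eq_bigr => b _.
  case: (0 < b)%N => //=; case: eqP => [<-|_]; first by rewrite dvdn_gcdr mulr1.
  by rewrite mulr0 if_same.
rewrite mulrC; congr (_ * _).
rewrite en (sum_multiples m (fun b => (gcdn (a * m) b == a)%:R) a0).
under eq_bigr => c _ do rewrite -muln_gcdr -[X in _ == X]muln1 eqn_pmul2l //.
rewrite (sum_gcd_shift m (fun g => (g == 1%N)%:R)) totient_count_coprime big_mkord natr_sum.
by apply: eq_bigr.
Qed.

Lemma sum_gcd (f : nat -> rat) :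
  \sum_(b < n.+1 | (0 < b)%N) f (gcdn n b) =
  \sum_(a < n.+1 | (a %| n)%N) (totient (n %/ a))%:R * f a.
Proof.
have le b : (gcdn n b < n.+1)%N by rewrite ltnS dvdn_leq ?dvdn_gcdl.
rewrite (partition_big (fun b : 'I_n.+1 => Ordinal (le b))
                       (fun a : 'I_n.+1 => (a %| n)%N)) /=; last first.
  by move=> b _; rewrite dvdn_gcdl.
by apply: eq_bigr => a dv; rewrite -sum_gcd_class // mulnC divnK.
Qed.

Lemma sum_divisors_swap (G : nat -> nat -> rat) :
  \sum_(a < n.+1 | (a %| n)%N) G a (n %/ a)%N = \sum_(a < n.+1 | (a %| n)%N) G (n %/ a)%N a.
Proof.
have lt a : (n %/ a < n.+1)%N by rewrite ltnS leq_div.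
have inv a : (a %| n)%N -> (n %/ (n %/ a) = a)%N.
  move=> dv; have a0 : (0 < a)%N by apply: dvdn_gt0 dv.
  have d0 : (0 < n %/ a)%N by rewrite divn_gt0 // dvdn_leq.
  by apply/eqP; rewrite -(eqn_pmul2r d0) divnK ?dvdn_div // mulnC divnK.
rewrite (reindex_onto (fun a : 'I_n.+1 => Ordinal (lt a)) (fun a : 'I_n.+1 => Ordinal (lt a))) /=.
  apply: eq_big => a; last by move=> /andP[_ /eqP e]; congr (G _ _); exact: (congr1 val e).
  apply/andP/idP => [[h /eqP e]|h]; first by rewrite -e /= dvdn_div.
  by split; [rewrite dvdn_div | apply/eqP/val_inj; rewrite /= inv].
by move=> a h; apply: val_inj; rewrite /= inv.
Qed.
End DivisorSum.

(** Grouped by divisors the sum is that of totient(n/a) a totient(a). Exchanging a with n/a turns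
    the summand into n psi(a) totient(n/a), the corresponding term of n times the zeroth moment. *)
Lemma sum_gcd_totient n : (1 < n)%N ->
  \sum_(b < n.+1 | (0 < b)%N) (gcdn n b)%:R * (totient (gcdn n b))%:R = J2 n.
Proof.
move=> n1; have n0 := ltnW n1.
rewrite (sum_gcd n0 (fun g => g%:R * (totient g)%:R)).
rewrite -(moment0 n1) /moment; under [in RHS]eq_bigr => b _ do rewrite expr0 mul1r.
rewrite (sum_gcd n0 psi) mulr_sumr.
rewrite (sum_divisors_swap n0 (fun a m => (totient m)%:R * (a%:R * (totient a)%:R))).
apply: eq_bigr => a dv; have a0 : (0 < a)%N by apply: dvdn_gt0 dv.
have nz : ((a : nat)%:R : rat) != 0 by rewrite pnatr_eq0 -lt0n.
have en : (n%:R : rat) = (n %/ a)%:R * (a : nat)%:R by rewrite -natrM divnK.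
by rewrite en /psi; field.
Qed.

(** * Summation over pairs of cylinders *)

Lemma gcdn_subr a n : (a <= n)%N -> gcdn a (n - a) = gcdn n a.
Proof. by move=> le; rewrite [RHS]gcdnC -{2}(subnK le) gcdnDr. Qed.

Section QuadSums.
Variable n : nat.
Hypothesis n1 : (1 < n)%N.
Let n0 : (0 < n)%N := ltnW n1.
Local Notation quad := ('I_n.+1 * 'I_n.+1 * 'I_n.+1 * 'I_n.+1)%type.

Definition isquad (k : quad) :=
  let: (a, b, x, y) := k in
  [&& 0 < a, 0 < b, 0 < x, 0 < y, a * x + b * y == n & coprime x y]%N.

(** Here a, b are the widths and x, y the heights. The factor [psi] is built in because the swap and
    the shear both preserve gcd(a, b); only the weight [F] changes. *)
Definition qsum (C : nat -> nat -> nat -> nat -> bool) (F : nat -> nat -> rat) : rat :=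
  \sum_(k : quad | isquad k && C k.1.1.1 k.1.1.2 k.1.2 k.2)
    F k.1.1.1 k.1.1.2 * psi (gcdn k.1.1.1 k.1.1.2).

Lemma qsum_eq C C' F F' : (forall a b x y, C a b x y = C' a b x y) ->
  (forall a b, F a b = F' a b) -> qsum C F = qsum C' F'.
Proof. by move=> eC eF; apply: eq_big => [k|k _]; rewrite ?eC ?eF. Qed.

Lemma qsum_swap C F : qsum C F = qsum (fun a b x y => C b a y x) (fun a b => F b a).
Proof.
pose h (k : quad) : quad := let: (a, b, x, y) := k in (b, a, y, x).
have hK : involutive h by move=> [[[a b] x] y].
rewrite /qsum (reindex_inj (inv_inj hK)); apply: eq_big => [[[[a b] x] y]|[[[a b] x] y] _] /=.
  rewrite addnC coprime_sym.
  by case: (0 < a)%N; case: (0 < b)%N; case: (0 < x)%N; case: (0 < y)%N.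
by rewrite gcdnC.
Qed.

Lemma qsum_split C C' F :
  qsum C F = qsum (fun a b x y => C a b x y && C' a b x y) F
             + qsum (fun a b x y => C a b x y && ~~ C' a b x y) F.
Proof.
rewrite /qsum (bigID (fun k : quad => C' k.1.1.1 k.1.1.2 k.1.2 k.2)) /=.
by congr (_ + _); apply: eq_bigl => k; rewrite andbA.
Qed.

Lemma qsumD C F G : qsum C (fun a b => F a b + G a b) = qsum C F + qsum C G.
Proof. by rewrite /qsum -big_split; apply: eq_bigr => k _; rewrite mulrDl. Qed.

(* Shearing preserves a x + b y, gcd(a, b) and gcd(x, y). *)
Lemma qsum_shear F :
  qsum (fun a b _ _ => a < b)%N F = qsum (fun _ _ x y => y < x)%N (fun a b => F a (a + b)%N).
Proof.
pose h (k : quad) : quad := (k.1.1.1, inord (k.1.1.1 + k.1.1.2), inord (k.1.2 - k.2), k.2).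
pose h' (k : quad) : quad := (k.1.1.1, inord (k.1.1.2 - k.1.1.1), inord (k.1.2 + k.2), k.2).
have vin m : (m <= n)%N -> @inord n m = m :> nat by move=> le; rewrite inordK.
have cps x y : (y < x)%N -> coprime (x - y) y = coprime x y.
  by move=> yx; rewrite -{2}(subnK (ltnW yx)) ![coprime _ y]coprime_sym /coprime gcdnDr.
rewrite /qsum (reindex_onto h h'); last first.
  case=> [[[a b] x] y] /= /andP[/and5P[a0 b0 x0 y0 /andP[/eqP e _]] ab].
  have bn := ltn_ord b; have le1 : (b - a <= n)%N by lia.
  have le2 : (x + y <= n)%N by nia.
  rewrite /h /h' /=; congr (_, _, _, _); apply: val_inj => /=.
    by rewrite !vin; lia.
  by rewrite !vin; lia.
apply: eq_big => [[[[a b] x] y]|[[[a b] x] y]]; rewrite /h /h' /=.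
  have xn := ltn_ord x; have an := ltn_ord a; have bn := ltn_ord b.
  have le1 : (x - y <= n)%N by lia.
  apply/idP/idP.
    case/andP=> /andP[/and5P[a0 b0 x0 y0 /andP[/eqP e cp]] ab] _.
    (* An overflowing sum makes [inord] return 0, contrary to positivity of the second width.
       Likewise truncated subtraction gives x - y = 0 unless y < x. *)
    have le2 : (a + b <= n)%N.
      rewrite leqNgt; apply/negP=> gt.
      by move: b0; rewrite /inord /insubd insubF //= ltnS leqNgt gt.
    rewrite (vin _ le1) (vin _ le2) in b0 x0 e cp ab.
    have yx : (y < x)%N by lia.
    rewrite a0 y0 yx !andbT /=; apply/and4P; split; [lia | lia | apply/eqP; nia |].
    by rewrite -cps.
  case/andP=> /and5P[a0 b0 x0 y0 /andP[/eqP e cp]] yx.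
  have le2 : (a + b <= n)%N by nia.
  rewrite (vin _ le1) (vin _ le2) a0 y0 /=; apply/andP; split; last first.
    apply/eqP; congr (_, _, _, _); apply: val_inj; rewrite /= vin; lia.
  apply/andP; split; last by lia.
  apply/and4P; split; [lia | lia | apply/eqP; nia |].
  by rewrite cps.
case/andP=> /andP[/and5P[a0 b0 _ _ _] _] _.
have le2 : (a + b <= n)%N.
  rewrite leqNgt; apply/negP=> gt.
  by move: b0; rewrite /inord /insubd insubF //= ltnS leqNgt gt.
by rewrite (vin _ le2) gcdnDl.
Qed.

(** Coprime equal heights are both 1, so b = n - a and gcd(a, b) = gcd(n, a). *)
Lemma qsum_xx F : qsum (fun _ _ x y => x == y)%N F =
  \sum_(a < n.+1 | (0 < a < n)%N) F a (n - a)%N * psi (gcdn n a).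
Proof.
have vin m : (m <= n)%N -> @inord n m = m :> nat by move=> le; rewrite inordK.
pose h (a : 'I_n.+1) : quad := (a, inord (n - a), inord 1, inord 1).
rewrite /qsum (reindex_onto h (fun k => k.1.1.1)) /=; last first.
  case=> [[[a b] x] y] /= /andP[/and5P[a0 b0 x0 y0 /andP[/eqP e cp]] /eqP xy].
  have x1 : x = 1%N :> nat by move: cp; rewrite -xy /coprime gcdnn => /eqP.
  have y1 : y = 1%N :> nat by rewrite -xy.
  rewrite /h; congr (_, _, _, _); apply: val_inj => /=; rewrite vin //; lia.
apply: eq_big => [a|a]; rewrite /h /= !vin ?leq_subr //.
  have le : (a <= n)%N by rewrite -ltnS.
  by rewrite !eqxx !andbT /= !muln1 subnKC // eqxx !andbT subn_gt0.
move=> /andP[/andP[/and5P[a0 b0 _ _ _] _] _].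
congr (_ * psi _); have le : (a <= n)%N by rewrite -ltnS.
exact: gcdn_subr.
Qed.

(** When a = b, n = a (x + y) with x, y coprime. The single number c = a x determines the solution,
    since a = gcd(n, c). *)
Lemma qsum_aa F : qsum (fun a b _ _ => a == b)%N F =
  \sum_(c < n.+1 | (0 < c < n)%N) F (gcdn n c) (gcdn n c) * psi (gcdn n c).
Proof.
have vin m : (m <= n)%N -> @inord n m = m :> nat by move=> le; rewrite inordK.
pose h (c : 'I_n.+1) : quad := (inord (gcdn n c), inord (gcdn n c),
  inord (c %/ gcdn n c), inord ((n - c) %/ gcdn n c)).
pose h' (k : quad) : 'I_n.+1 := inord (k.1.1.1 * k.1.2).
have gn c : (gcdn n c <= n)%N by rewrite dvdn_leq ?dvdn_gcdl.
rewrite /qsum (reindex_onto h h') /=; last first.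
  case=> [[[a b] x] y] /= /andP[/and5P[a0 b0 x0 y0 /andP[/eqP e cp]] /eqP ab].
  rewrite -ab in e; have le : (a * x <= n)%N by lia.
  have eg : gcdn n (a * x) = a.
    by rewrite -[X in gcdn X _]e -mulnDr -muln_gcdr gcdnC gcdnDl (eqP cp) muln1.
  rewrite /h /h' /= (vin _ le) eg; congr (_, _, _, _); apply: val_inj => /=.
  - by rewrite vin // -ltnS.
  - by rewrite vin // -ltnS.
  - by rewrite mulKn // vin // -ltnS.
  have -> : (n - a * x = a * y)%N by lia.
  by rewrite mulKn // vin // -ltnS.
have dn c d : (c <= n)%N -> (c %/ d <= n)%N by move=> le; apply: leq_trans le; apply: leq_div.
apply: eq_big => [c|c]; have cn : (c <= n)%N by rewrite -ltnS.
  have g0 : (0 < gcdn n c)%N by rewrite gcdn_gt0 n0.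
  have gc : (gcdn n c %| c)%N by rewrite dvdn_gcdr.
  have gnc : (gcdn n c %| n - c)%N by rewrite dvdn_sub ?dvdn_gcdl.
  rewrite /h /h' /= !vin ?gn ?dn ?leq_subr // g0 eqxx andbT.
  have -> : (inord (gcdn n c * (c %/ gcdn n c)) == c) = true.
    by rewrite mulnC divnK // inord_val eqxx.
  rewrite andbT !divn_gt0 // ![(gcdn n c * _)%N]mulnC !divnK // subnKC // eqxx /=.
  apply/idP/idP => [/and3P[h1 h2 _]|/andP[c0 cn']].
    rewrite (leq_trans g0 h1) /=; move: (leq_trans g0 h2); lia.
  apply/and3P; split; [exact: dvdn_leq | by apply: dvdn_leq => //; lia |].
  rewrite /coprime -(eqn_pmul2l g0) muln_gcdr ![(gcdn n c * _)%N]mulnC !divnK // mul1n.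
  by rewrite gcdn_subr.
by move=> _; rewrite /h /= !vin // gcdnn.
Qed.

Lemma sum_split_last (f : nat -> rat) :
  \sum_(a < n.+1 | (0 < a)%N) f a = \sum_(a < n.+1 | (0 < a < n)%N) f a + f n.
Proof.
rewrite big_mkcond big_ord_recr /= n0; congr (_ + _).
rewrite [RHS]big_mkcond big_ord_recr /= n0 ltnn /= addr0.
by apply: eq_bigr => a _; rewrite ltn_ord andbT.
Qed.

Lemma moment_split k : moment n k = \sum_(a < n.+1 | (0 < a < n)%N) a%:R ^+ k * psi (gcdn n a)
   + n%:R ^+ k * psi n.
Proof. by rewrite /moment (sum_split_last (fun a => a%:R ^+ k * psi (gcdn n a))) gcdnn. Qed.

Lemma totient_psi : (totient n)%:R = n%:R * psi n.
Proof.
have nz : (n%:R : rat) != 0 by rewrite pnatr_eq0 -lt0n.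
by rewrite /psi mulrC divfK.
Qed.

(** The shear turns the weight a b into a^2 + a b, so sums of squares have to be carried along.
    Splitting each total both by comparing a with b and by comparing x with y supplies the missing
    relations. *)
Lemma qsum_cylinders :
  qsum (fun a b _ _ => a < b)%N (fun a b => a%:R * b%:R)
   = 5 / 24 * n%:R * J2 n - 3 / 4 * J2 n + n%:R * (totient n)%:R / 2.
Proof.
set X := qsum _ _.
set D := qsum (fun a b _ _ => a == b)%N (fun a b => a%:R * b%:R).
set D2 := qsum (fun a b _ _ => a == b)%N (fun a b => a%:R ^+ 2).
set al1 := qsum (fun a b _ _ => a < b)%N (fun a b => a%:R ^+ 2).
set al2 := qsum (fun a b _ _ => a < b)%N (fun a b => b%:R ^+ 2).
set be1 := qsum (fun _ _ x y => y < x)%N (fun a b => a%:R ^+ 2).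
set be2 := qsum (fun _ _ x y => y < x)%N (fun a b => b%:R ^+ 2).
set ga := qsum (fun _ _ x y => y < x)%N (fun a b => a%:R * b%:R).
set M := qsum (fun _ _ x y => x == y)%N (fun a b => a%:R * b%:R).
set M2 := qsum (fun _ _ x y => x == y)%N (fun a b => a%:R ^+ 2).
have trichoab F : qsum (fun _ _ _ _ => true) F =
    qsum (fun a b _ _ => a < b)%N F + qsum (fun a b _ _ => a == b)%N F
    + qsum (fun a b _ _ => a < b)%N (fun a b => F b a).
  rewrite (qsum_split _ (fun a b _ _ => a < b)%N) -addrA; congr (_ + _).
  rewrite (qsum_split _ (fun a b _ _ => a == b)%N); congr (_ + _).
    by apply: qsum_eq => // a b _ _ /=; case: ltngtP.
  by rewrite qsum_swap; apply: qsum_eq => // a b _ _ /=; case: ltngtP.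
have trichoxy F : qsum (fun _ _ _ _ => true) F =
    qsum (fun _ _ x y => y < x)%N F + qsum (fun _ _ x y => x == y)%N F
    + qsum (fun _ _ x y => y < x)%N (fun a b => F b a).
  rewrite (qsum_split _ (fun _ _ x y => y < x)%N) -addrA; congr (_ + _).
  rewrite (qsum_split _ (fun _ _ x y => x == y)%N); congr (_ + _).
    by apply: qsum_eq => // _ _ x y /=; case: ltngtP.
  by rewrite qsum_swap; apply: qsum_eq => // _ _ x y /=; case: ltngtP.
(* E1 to E5 are linear in the six sums X, al1, al2, be1, be2, ga and leave X
   expressed by the diagonal sums D, M, M2. *)
have E1 : al1 = be1 by rewrite /al1 qsum_shear.
have E2 : al2 = be1 + 2 * ga + be2.
  rewrite /al2 qsum_shear (qsum_eq (C' := fun _ _ x y => (y < x)%N)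
    (F' := fun a b => a%:R ^+ 2 + ((a%:R * b%:R + a%:R * b%:R) + b%:R ^+ 2))) //.
    by rewrite !qsumD /be1 /be2 /ga; ring.
  by move=> a b; rewrite natrD; ring.
have E3 : X = be1 + ga.
  rewrite /X qsum_shear (qsum_eq (C' := fun _ _ x y => (y < x)%N)
    (F' := fun a b => a%:R ^+ 2 + a%:R * b%:R)) ?qsumD //.
  by move=> a b; rewrite natrD; ring.
have E4 : X + D + X = ga + M + ga.
  have sy C : qsum C (fun a b => b%:R * a%:R) = qsum C (fun a b => a%:R * b%:R).
    by apply: qsum_eq => // a b; rewrite mulrC.
  by have := trichoab (fun a b => a%:R * b%:R); rewrite trichoxy !sy => ->.
have E5 : al1 + D2 + al2 = be1 + M2 + be2.
  by have := trichoab (fun a b => a%:R ^+ 2); rewrite trichoxy => ->.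
have E6 : D2 = D.
  rewrite /D2 /D !qsum_aa; apply: eq_bigr => c _; by rewrite expr2.
have ED : D = J2 n - n%:R * (totient n)%:R.
  rewrite -(sum_gcd_totient n1) /D qsum_aa.
  rewrite (sum_split_last (fun c => (gcdn n c)%:R * (totient (gcdn n c))%:R)) gcdnn addrK.
  apply: eq_bigr => c _.
  have nz : ((gcdn n c)%:R : rat) != 0 by rewrite pnatr_eq0 -lt0n gcdn_gt0 n0.
  by rewrite /psi; field.
have EM2 : M2 = moment n 2 - n%:R * (totient n)%:R.
  by rewrite moment_split /M2 qsum_xx totient_psi; ring.
have EM : M = n%:R * moment n 1 - moment n 2.
  rewrite !moment_split /M qsum_xx mulrDr mulr_sumr.
  have -> : n%:R * (n%:R ^+ 1 * psi n) = n%:R ^+ 2 * psi n by ring.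
  rewrite opprD addrACA subrr addr0 -sumrB; apply: eq_bigr => a _.
  have le : (a <= n)%N by rewrite -ltnS.
  by rewrite natrB //; ring.
have EM' : M = (n%:R * J2 n) / 6 by rewrite EM (moment1 n1) (moment2 n1); field.
have EM2' : M2 = (n%:R * J2 n) / 3 - (n%:R * (totient n)%:R) / 2 by rewrite EM2 (moment2 n1); field.
have -> : 5 / 24 * n%:R * J2 n = 5 / 24 * (n%:R * J2 n) by ring.
move: E1 E2 E3 E4 E5 E6 ED EM2' EM'; move: (n%:R * J2 n) (n%:R * (totient n)%:R) (J2 n) => u v J.
move: X D D2 al1 al2 be1 be2 ga M M2 {EM EM2} => X D D2 al1 al2 be1 be2 ga M M2.
(* Elimination gives be1 = (M - D)/2 and ga = (M2 - D - be1)/2, hence X = M2/2 + M/4 - 3 D/4. *)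
by clear; lra.
Qed.
End QuadSums.

(** Heights that are not coprime contribute nothing, and for coprime ones [card_goodtwist] evaluates
    the number of twists as w1 w2 psi(gcd(w1, w2)). *)
Lemma card_two_cyl_qsum n : (1 < n)%N ->
  (#|two_cyl n|%:R : rat) = (n`!)%:R * qsum n (fun a b _ _ => a < b)%N (fun a b => a%:R * b%:R).
Proof.
move=> n1; rewrite card_two_cyl natrM; congr (_ * _).
rewrite natr_sum (bigID (fun k : 'I_n.+1 * 'I_n.+1 * 'I_n.+1 * 'I_n.+1 => coprime k.1.2 k.2)).
rewrite /= [X in _ + X]big1 ?addr0; last first.
  case=> [[[a b] x] y] /= /andP[_ nc]; rewrite eq_card0 // => t.
  by rewrite !inE /goodtwist (negPf nc).
apply: eq_big => [[[[a b] x] y]|[[[a b] x] y]] /=.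
  case: (posnP a) => //= a0; case: (ltnP a b) => [ab|] /=; last by rewrite !andbF.
  by rewrite (ltn_trans a0 ab) !andbT -!andbA.
case/andP=> /and5P[a0 ab x0 y0 _] cp.
have b0 := ltn_trans a0 ab.
have nz : ((gcdn a b)%:R : rat) != 0 by rewrite pnatr_eq0 -lt0n gcdn_gt0 a0.
have /(congr1 (fun k => k%:R : rat)) := card_goodtwist a0 b0 x0 cp.
rewrite !natrM => e; apply: (mulIf nz); rewrite /psi -[RHS]mulrA divfK // -e.
by congr (_%:R * _); apply: eq_card => t; rewrite !inE /goodtwist cp.
Qed.

Theorem mainTheorem18 (n : nat) (hn : (2 < n)%N) :
  (#|cA n|%:R : rat) =
    ((3%:R / 8%:R) * (n - 2)%:R * J2 n * (n`!)%:R)%R.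
Proof.
have n1 : (1 < n)%N by apply: ltnW.
have n0 : (0 < n)%N by apply: ltnW.
have -> : #|cA n| = (#|[set st in cA n | fullcycle st.1]|
                     + #|[set st in cA n | ~~ fullcycle st.1]|)%N.
  rewrite -!sum1_card (bigID (fun st => fullcycle st.1)) /=.
  by congr (_ + _)%N; apply: eq_bigl => st; rewrite [in RHS]inE.
rewrite natrD card_not_fullcycle card_two_cyl_qsum // qsum_cylinders //.
have /(congr1 (fun k => k%:R : rat)) := card_fullcycle (o := Ordinal n0) erefl.
rewrite card_rotn_partners // !natrM => e1.
have e2 := card_tripleset n1 (o := Ordinal n0) erefl.
have -> : ((n - 2)%:R : rat) = n%:R - 2 by rewrite natrB // ltnW.
have -> : (#|[set st in cA n | fullcycle st.1]|%:R : rat) =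
          (n`!)%:R * (n%:R * (J2 n - 3 * (totient n)%:R)) / 6.
  by apply: (@mulfI _ 3) => //; rewrite e1 e2; field.
(* The terms in n totient(n) cancel, n J2 has coefficient 1/6 + 5/24 = 3/8, and -3/4 is 3/8 times
   -2. *)
by field.
Qed.
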